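(* Let $E$ be a Banach space and let $I$ be an interval of $\mathbb R\cup\{\infty\}$ with $-\infty<\min I<\sup I\le\infty$. Assume that $g:I\to E$ is right regulated. Then: (a) $g$ is locally HL integrable if and only if it has a CD primitive. (b) $g$ is locally Bochner integrable if and only if it has a locally absolutely continuous CD primitive. (c) $g$ is locally Riemann integrable if and only if it is locally bounded, in which case $g$ has a locally Lipschitz continuous CD primitive.
   Context: A mapping $g:I\to E$ is right regulated if it has a right limit in $E$ at every point of $I\setminus\{\sup I\}$. A CD primitive of $g:I\to E$ is a continuous mapping $f:I\setminus\{\sup I\}\to E$ that is differentiable in the complement of a countable subset $Z$ of $I$, with $f'(t)=g(t)$ for each $t\in I\setminus Z$. A property (integrability in a given sense, boundedness, absolute continuity, Lipschitz continuity) holds locally for a function defined on an interval if the function has that property on every compact subinterval of that interval; in particular, $g:I\to E$ is locally HL, Bochner or Riemann integrable if it is HL, Bochner or Riemann integrable, respectively, on every compact subinterval of $I$. A mapping $g:[a,b]\to E$ ($-\infty<a<b<\infty$) is HL (Henstock–Lebesgue) integrable if there is a mapping $f:[a,b]\to E$ such that for each $\epsilon>0$ there is $\delta:[a,b]\to(0,\infty)$ such that whenever $a=t_0<\dots<t_m=b$ and $\xi_i\in[t_{i-1},t_i]\subset(\xi_i-\delta(\xi_i),\xi_i+\delta(\xi_i))$ for $i=1,\dots,m$, then $\sum_{i=1}^m\|f(t_i)-f(t_{i-1})-g(\xi_i)(t_i-t_{i-1})\|<\epsilon$. It is HK (Henstock–Kurzweil) integrable if the same holds with the last inequality replaced by $\left\|\sum_{i=1}^m(f(t_i)-f(t_{i-1})-g(\xi_i)(t_i-t_{i-1}))\right\|<\epsilon$,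 and Riemann integrable if in the definition of HK integrability the functions $\delta$ are replaced by positive constants. Bochner integrability is the usual notion: $g$ is strongly measurable and $t\mapsto\|g(t)\|$ is Lebesgue integrable.
   Formalization: In (a) and (b), local HL and Bochner integrability is required on compact subintervals of I without sup I, not of I; if sup I lies in I the claim as written fails, e.g. g(t)=(1-t)^-2 on [0,1), g(1)=0. *)

(* Defs.v *)
From HB Require Import structures.
From mathcomp Require Import all_boot all_order all_algebra.
From mathcomp Require Import all_classical all_reals all_analysis.

Set Implicit Arguments.
Unset Strict Implicit.
Unset Printing Implicit Defensive.
Import Order.TTheory GRing.Theory Num.Theory.
Import numFieldNormedType.Exports.
Local Open Scope classical_set_scope.
Local Open Scope ring_scope.

Definition ereal_interval (R : realType) (I : set (\bar R)) : Prop :=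
  forall x y z : \bar R, I x -> I y -> (x <= z)%E -> (z <= y)%E -> I z.

(* A map g : I -> E is represented by a total function on \bar R whose values
   outside I are never used. If +oo belongs to I then it is sup I, so that
   I \ {sup I} consists of real points as soon as min I is finite. *)
Definition real_part (R : realType) (I : set (\bar R)) : set R :=
  [set t | I t%:E].
Definition sup_removed (R : realType) (I : set (\bar R)) : set R :=
  [set t | I t%:E /\ t%:E <> ereal_sup I].

Definition right_regulated (R : realType) (E : normedModType R)
    (I : set (\bar R)) (g : \bar R -> E) : Prop :=
  forall t : R, sup_removed I t ->
    exists l : E, g x%:E @[x --> t^'+] --> l.

(* Only t = min I could see the values of [f] outside its domain through the
   two-sided derivative; this is immaterial, as Z may contain that point. *)
Definition CD_primitive (R : realType) (E : normedModType R)
    (I : set (\bar R)) (g : \bar R -> E) (f : R -> E) : Prop :=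
  {within sup_removed I, continuous f} /\
  exists Z : set (\bar R),
    [/\ countable Z, Z `<=` I &
        forall t : R, sup_removed I t -> ~ Z t%:E ->
          is_derive t 1 f (g t%:E)].

(* P holds locally on J: only nondegenerate compact subintervals with finite
   endpoints matter. A CD primitive of g lives on I \ {sup I}, which differs
   from I when I is closed on the right. Integrability of g up to sup I cannot
   be read off from it in that case: g t = (1 - t)^-2 on [0, 1), g 1 = 0, has
   the CD primitive (1 - t)^-1 on [0, 1), but is not integrable on [0, 1].
   Hence J = I \ {sup I} is the domain on which the existence of a primitive
   is to be compared with local integrability. *)
Definition locally_on (R : realType) (J : set R) (P : R -> R -> Prop) : Prop :=
  forall c d : R, c < d -> `[c, d] `<=` J -> P c d.

(* c = t_0 < ... < t_m = d with tags xi_i in [t_i, t_{i+1}], i < m (the tags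
   are indexed from 0), and [t_i, t_{i+1}] contained in the open interval of
   radius delta (xi_i) centred at xi_i. *)
Definition fine_tagged_partition (R : realType) (c d : R) (delta : R -> R)
    (m : nat) (t xi : nat -> R) : Prop :=
  [/\ t 0%N = c, t m = d,
      forall i, (i < m)%N -> t i < t i.+1 &
      forall i, (i < m)%N ->
        t i <= xi i <= t i.+1 /\
        `[t i, t i.+1] `<=` `]xi i - delta (xi i), xi i + delta (xi i)[ ].

Definition HL_integrable (R : realType) (E : normedModType R)
    (g : R -> E) (c d : R) : Prop :=
  exists f : R -> E, forall e : R, 0 < e ->
    exists delta : R -> R,
      (forall x, x \in `[c, d] -> 0 < delta x) /\
      forall (m : nat) (t xi : nat -> R),
        fine_tagged_partition c d delta m t xi ->
        \sum_(i < m)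
          `| f (t i.+1) - f (t i) - (t i.+1 - t i) *: g (xi i) | < e.

Definition Riemann_integrable (R : realType) (E : normedModType R)
    (g : R -> E) (c d : R) : Prop :=
  exists f : R -> E, forall e : R, 0 < e ->
    exists delta : R, 0 < delta /\
      forall (m : nat) (t xi : nat -> R),
        fine_tagged_partition c d (fun=> delta) m t xi ->
        `| \sum_(i < m)
             (f (t i.+1) - f (t i) - (t i.+1 - t i) *: g (xi i)) | < e.

Definition simple_on d (T : measurableType d) (E : Type)
    (D : set T) (s : T -> E) : Prop :=
  finite_set (s @` D) /\ forall y : E, measurable (D `&` s @^-1` [set y]).

Definition strongly_measurable d (T : measurableType d) (R : realType)
    (mu : {measure set T -> \bar R}) (E : normedModType R)
    (D : set T) (g : T -> E) : Prop :=
  exists s : nat -> T -> E,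
    (forall n, simple_on D (s n)) /\
    {ae mu, forall x, D x -> s n x @[n --> \oo] --> g x}.

(* The completed measure is used so that measurability is Lebesgue (and not
   Borel) measurability. *)
Definition Bochner_integrable (R : realType) (E : normedModType R)
    (g : R -> E) (c d : R) : Prop :=
  strongly_measurable (@completed_lebesgue_measure R) `[c, d]%classic g /\
  (@completed_lebesgue_measure R).-integrable `[c, d]%classic
    (fun t => (`| g t |)%:E).

Definition absolutely_continuous (R : realType) (E : normedModType R)
    (f : R -> E) (c d : R) : Prop :=
  forall e : R, 0 < e -> exists delta : R, 0 < delta /\
    forall (n : nat) (u v : 'I_n -> R),
      (forall i, [/\ c <= u i, u i <= v i & v i <= d]) ->
      trivIset [set: 'I_n] (fun i => `]u i, v i[%classic) ->
      \sum_i (v i - u i) < delta ->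
      \sum_i `| f (v i) - f (u i) | < e.

Definition bounded_between (R : realType) (E : normedModType R)
    (g : R -> E) (c d : R) : Prop :=
  [bounded g x | x in `[c, d]%classic].

Definition Lipschitz_between (R : realType) (E : normedModType R)
    (f : R -> E) (c d : R) : Prop :=
  [lipschitz f x | x in `[c, d]%classic].

(* Main.v *)
Require Import Defs.
From HB Require Import structures.
From mathcomp Require Import all_boot all_order all_algebra.
From mathcomp Require Import all_classical all_reals all_analysis.
From mathcomp Require Import measurable_realfun lra.
Import Order.TTheory GRing.Theory Num.Theory.
Import numFieldNormedType.Exports.
Local Open Scope classical_set_scope.
Local Open Scope ring_scope.

Set Implicit Arguments.
Unset Strict Implicit.
Unset Printing Implicit Defensive.

(** Everything rests on one observation. A right regulated map is continuous
outside a countable set, and countably many exceptional points can be neglected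
in additive estimates by means of a jump function: for a countable set [Z] there
is a bounded nondecreasing [J] that increases by a fixed positive amount on
every nondegenerate interval containing a given point of [Z]
([jump_function]). An additive estimate is therefore needed only for small
intervals containing a given point [x], up to an error [e * (t - s)] if [x] is
not in [Z] and up to an arbitrarily small constant error if it is; interval
induction, a form of Cousin's lemma, then yields it on the whole interval
([interval_ind], [small_subadditive]).

The Henstock-Lebesgue integral fits this pattern. Taking the supremum, over the
fine tagged partitions of [[c, x]], of the sums in its definition as a function
of [x] shows that [f] is an indefinite integral of [g] iff the increments of
[f] differ from [(t - s) *: g x], on small intervals tagged by [x], by at most
the increments of a nondecreasing function of arbitrarily small total increase
([variational_primitive], [HL_variational], [variational_HL]). Such an [f] is
continuous and has derivative [g] at the continuity points of [g]; conversely a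
CD primitive has this property because of the jump function. Gluing primitives
along the intervals [[a, d]] then settles the Henstock-Lebesgue case.

In the Bochner and Riemann cases a variational primitive must be constructed.
This is possible whenever [g] is continuous off a countable set and its norm is
there at most the derivative of a continuous nondecreasing [H]: approximate
primitives are affine near a continuity point and constant near an exceptional
one, where the error is controlled by the small increments of [H]; they are
patched by interval induction, and completeness gives a limit
([dominated_approximation], [variational_limit]). For bounded [g] take
[H x = M * x], for Bochner integrable [g] the indefinite Lebesgue integral of the
norm. In the second case [`|f t - f s| <= H t - H s], so [f] inherits absolute
continuity from [H].

Conversely, if the CD primitive [f] is absolutely continuous, it has locally a
variation function [V]. The primitives of the truncations [min (norm g) n]
increase at most as much as [V], so monotone convergence bounds the integral of
the norm, while step functions on fine grids give strong measurability.

Finally, a Riemann sum of a Riemann integrable [g] over a fixed fine partition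
changes little if one tag moves, so [g] is bounded. In the other direction the
increments of the primitive of a bounded [g] are controlled on all sufficiently
short intervals, with a bound on the length that does not depend on the tag
([bounded_uniform_control]), and this gives Riemann integrability. *)

(** * Straddling intervals and interval induction *)

(** Eventually for the intervals around [x]: a derivative at [x] is a statement
about the increments over all small intervals [[s, t]] of [[c, d]] that contain
[x], not only over those with an end at [x]. In this form tags, end points and
one-sided situations need no separate treatment. *)
Definition straddle (R : realType) (c d x : R) (P : R -> R -> Prop) : Prop :=
  exists2 r : R, 0 < r & forall s t : R, c <= s -> s <= x -> x <= t -> t <= d ->
    s < t -> x - r < s -> t < x + r -> P s t.

Section Straddle.
Context {R : realType}.
Implicit Types (c d x : R) (P Q : R -> R -> Prop).

Lemma straddle_mono c d c' d' x P Q : c <= c' -> d' <= d ->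
  (forall s t, c' <= s -> s <= x -> x <= t -> t <= d' -> s < t ->
    P s t -> Q s t) ->
  straddle c d x P -> straddle c' d' x Q.
Proof.
move=> cc' d'd PQ [r r0 H]; exists r => // s t cs sx xt td st rs tr.
by apply: PQ => //; apply: H => //; [exact: le_trans cs|exact: le_trans td _].
Qed.

Lemma straddle_imp c d x P Q :
  (forall s t, c <= s -> s <= x -> x <= t -> t <= d -> s < t ->
    P s t -> Q s t) ->
  straddle c d x P -> straddle c d x Q.
Proof. exact: straddle_mono. Qed.

Lemma straddleW c d x P :
  (forall s t, c <= s -> s <= x -> x <= t -> t <= d -> s < t -> P s t) ->
  straddle c d x P.
Proof. by move=> H; exists 1 => // s t *; apply: H. Qed.

Lemma straddle_and c d x P Q : straddle c d x P -> straddle c d x Q ->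
  straddle c d x (fun s t => P s t /\ Q s t).
Proof.
move=> [r r0 H] [r' r'0 H']; exists (Num.min r r'); first by rewrite lt_min r0.
move=> s t cs sx xt td st; rewrite ltrBlDr -ltrBlDl lt_min => /andP[h1 h2].
rewrite -ltrBlDl lt_min => /andP[h3 h4].
by split; [apply: H => //; lra|apply: H' => //; lra].
Qed.

Lemma straddle_near c d x (e : R) : 0 < e ->
  straddle c d x (fun s t => x - e < s /\ t < x + e).
Proof. by move=> e0; exists e. Qed.

(** Cousin's lemma, stated as an induction principle so that no partition has to
be manipulated: the supremum of the points reached from [c] belongs to an
interval on which the property holds, hence is reached and equals [d]. *)
Lemma interval_ind P c d : c < d ->
  (forall u v w, c <= u -> u < v -> v < w -> w <= d ->
    P u v -> P v w -> P u w) ->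
  (forall x, c <= x -> x <= d -> straddle c d x P) -> P c d.
Proof.
move=> cd Pcat Ploc.
(* [c] is added by hand, as [P] speaks of nondegenerate intervals only. *)
pose S := [set x | c <= x <= d /\ (x = c \/ P c x)].
have Sc : S c by split; [rewrite lexx ltW|left].
have Sd : ubound S d by move=> x [/andP[]].
have supS : has_sup S by split; [exists c|exists d].
set s := sup S.
have cs : c <= s by apply: (ub_le_sup _ Sc); exists d.
have sd : s <= d by apply: ge_sup => //; exists c.
have [r r0 Hr] := Ploc s cs sd.
have [x [/andP[cx xd] Px] sx] : exists2 x, S x & s - r < x.
  exact: sup_adherent r0 supS.
have xs : x <= s by apply: ub_le_sup; [exists d|split; [rewrite cx|]].
have Ss : S s.
  split; first by rewrite cs.
  move: xs; rewrite le_eqVlt => /predU1P[<-//|xs]; right.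
  have Pxs : P x s by apply: Hr => //; lra.
  case: Px => [<-//|Pcx]; have [->//|xc] := eqVneq c x.
  by apply: (Pcat _ x) => //; rewrite lt_neqAle xc.
move: sd; rewrite le_eqVlt => /predU1P[sE|sd].
  by case: Ss => _; rewrite sE => -[dc|//]; rewrite dc ltxx in cd.
pose v := Num.min d (s + r / 2).
have sv : s < v by rewrite lt_min sd; lra.
have vd : v <= d by rewrite ge_min lexx.
have vr : v < s + r by rewrite gt_min; apply/orP; right; lra.
have Psv : P s v by apply: Hr => //; lra.
suff : v <= s by rewrite leNgt sv.
apply: ub_le_sup; first by exists d.
split; first by rewrite vd (le_trans cs (ltW sv)).
right; case: Ss => _ [<-//|Pcs]; have [->//|sc] := eqVneq c s.
by apply: (Pcat _ s) => //; rewrite lt_neqAle sc.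
Qed.

(** The sum, over an enumeration [z_k] of [Z], of jumps of size [2^-(k+2)]
placed just before and just after [z_k]. Two jumps at each point make the
increase visible also on intervals that have [z_k] as an end point. *)
Lemma jump_function (Z : set R) : countable Z ->
  exists (J w : R -> R), [/\ {homo J : x y / x <= y},
    forall x, 0 <= J x <= 1,
    forall z, Z z -> 0 < w z &
    forall z u v, Z z -> u <= z -> z <= v -> u < v -> w z <= J v - J u].
Proof.
move=> /countable_injP[n ninj].
(* A partial inverse of the enumeration [n]. *)
have [f fK] : exists f : nat -> option R, forall z, Z z -> f (n z) = Some z.
  exists (fun k => if pselect (exists2 z, Z z & n z = k) is left H
           then Some (s2val (cid2 H)) else None) => z Zz.
  case: pselect => [H|[]]; last by exists z.
  congr Some; case: cid2 => y /= Zy nyz.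
  by apply: ninj => //; rewrite inE.
pose b (z x : R) : R := ((z < x)%R : nat)%:R + ((z <= x)%R : nat)%:R.
pose a (x : R) k : R := (if f k is Some z then b z x else 0) * (2^-1 ^+ k.+2).
have b_homo z x y : x <= y -> b z x <= b z y.
  move=> xy; rewrite /b lerD// ler_nat.
    by case: (ltP z x) => // zx; rewrite (lt_le_trans zx xy).
  by case: (leP z x) => // zx; rewrite (le_trans zx xy).
have b0 z x : 0 <= b z x by rewrite addr_ge0.
have b2 z x : b z x <= 2 by rewrite /b; case: (z < x); case: (z <= x) => /=; lra.
have a_homo k x y : x <= y -> a x k <= a y k.
  by move=> xy; rewrite /a; case: (f k) => // z; rewrite ler_wpM2r// b_homo.
have a0 x k : 0 <= a x k.
  by rewrite /a mulr_ge0//; case: (f k).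
have a1 x k : a x k <= geometric 2^-1 2^-1 k.
  rewrite /a /= !exprS; set v := (X in X * _ <= _); set p := _ ^+ k.
  have : 0 <= (2 - v) * p.
    by rewrite mulr_ge0 ?exprn_ge0// subr_ge0 /v; case: (f k).
  lra.
have gs : series (geometric (2^-1 : R) 2^-1) @ \oo --> (1 : R).
  have := @cvg_geometric_series R 2^-1 2^-1.
  rewrite ger0_norm ?invr_ge0//; have -> : (2^-1 : R) / (1 - 2^-1) = 1.
    by rewrite (_ : 1 - 2^-1 = 2^-1) ?divff//; lra.
  by apply; lra.
have le1 x m : series (a x) m <= 1.
  apply: (@le_trans _ _ (series (geometric (2^-1 : R) 2^-1) m)).
    by rewrite !seriesEnat/=; apply: ler_sum => i _; exact: a1.
  have := @nondecreasing_cvgn_le R (series (geometric 2^-1 2^-1)) _ _ m.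
  rewrite (cvg_lim _ gs)//; apply; last exact: gs.
  apply/nondecreasing_seqP => k; rewrite !seriesEnat/= big_nat_recr//= lerDl.
  by rewrite mulr_ge0.
have nd x : nondecreasing_seq (series (a x)).
  by apply/nondecreasing_seqP => k; rewrite !seriesEnat/= big_nat_recr//= lerDl.
have ca x : cvgn (series (a x)).
  apply: nondecreasing_is_cvgn => //; exists 1 => _ [m _ <-]; exact: le1.
exists (fun x => limn (series (a x))), (fun z => 2^-1 ^+ (n z).+2); split.
- move=> x y xy; apply: ler_lim => //; near=> m.
  by rewrite !seriesEnat/=; apply: ler_sum => i _; exact: a_homo.
- move=> x; apply/andP; split.
    apply: limr_ge => //; near=> m; rewrite seriesEnat/=; exact: sumr_ge0.
  by apply: limr_le => //; near=> m; exact: le1.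
- by move=> z _; rewrite exprn_gt0.
- move=> z u v Zz uz zv uv; rewrite -limB//; apply: limr_ge; first exact: is_cvgB.
  near=> m.
  change (2^-1 ^+ (n z).+2 <= series (a v) m - series (a u) m).
  rewrite !seriesEnat/= -sumrB big_mkord.
  have mz : (n z < m)%N by near: m; exact: nbhs_infty_gt.
  rewrite (bigD1 (Ordinal mz))//= -[leLHS]addr0 lerD//; last first.
    by apply: sumr_ge0 => i _; rewrite subr_ge0 a_homo// ltW.
  rewrite /a (fK _ Zz) -mulrBl -[leLHS]mul1r ler_wpM2r// /b.
  have [zu|uz'] := leP z u.
    have -> : u = z by apply/eqP; rewrite eq_le uz zu.
    have zv' : z < v by apply: le_lt_trans zu uv.
    by rewrite ltxx zv' (ltW zv') /=; lra.
  rewrite zv (lt_gtF uz'); case: (z < v) => /=; lra.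
Unshelve. all: by end_near. Qed.

(** A mean value inequality with countably many exceptions: the errors
[e * (t - s)] add up to a multiple of [d - c], and those at the points of [Z] are
absorbed by the increments of a jump function. *)
Lemma small_subadditive (Z : set R) (D : R -> R -> R) c d : c < d ->
  countable Z ->
  (forall u v w, c <= u -> u < v -> v < w -> w <= d -> D u w <= D u v + D v w) ->
  (forall x, c <= x -> x <= d -> ~ Z x -> forall e : R, 0 < e ->
    straddle c d x (fun s t => D s t <= e * (t - s))) ->
  (forall x, c <= x -> x <= d -> Z x -> forall e : R, 0 < e ->
    straddle c d x (fun s t => D s t <= e)) ->
  D c d <= 0.
Proof.
move=> cd /jump_function[J [w [Jnd J01 w0 Jw]]] Dsub Dreg Dsing.
apply/ler_addgt0Pr => e e0; rewrite add0r.
(* [J] increases by at most [1], so the errors add up to at most [e]. *)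
pose k := e / (d - c + 1).
have k0 : 0 < k by rewrite divr_gt0//; lra.
suff H : D c d <= k * (d - c) + k * (J d - J c).
  apply: le_trans H _; rewrite -mulrDr /k mulrAC ler_pdivrMr; last lra.
  rewrite ler_pM2l//; have /andP[_ Jd] := J01 d; have /andP[Jc _] := J01 c; lra.
apply: (@interval_ind (fun s t => D s t <= k * (t - s) + k * (J t - J s))) => //.
  move=> u v w' cu uv vw wd; have := Dsub _ _ _ cu uv vw wd; lra.
move=> x cx xd; have [Zx|Zx] := pselect (Z x).
  apply: straddle_imp (Dsing x cx xd Zx _ (mulr_gt0 k0 (w0 _ Zx))).
  move=> s t cs sx xt td st /le_trans; apply.
  have h1 : 0 <= k * (t - s) by rewrite mulr_ge0 ?(ltW k0)// subr_ge0 ltW.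
  have h2 : k * w x <= k * (J t - J s) by rewrite ler_pM2l// Jw.
  by rewrite -[leLHS]add0r lerD.
apply: straddle_imp (Dreg x cx xd Zx _ k0) => s t cs sx xt td st /le_trans; apply.
by rewrite lerDl mulr_ge0// ?(ltW k0)// subr_ge0 Jnd// ltW.
Qed.

End Straddle.

(** * Variational primitives *)

(** [W] majorizes the error committed by replacing an increment of [f] over a
small interval by the increment of the affine map with slope [g x], for any tag
[x] in this interval. *)
Definition controls (R : realType) (E : normedModType R) (g : R -> E)
    (c d : R) (f : R -> E) (W : R -> R) : Prop :=
  (forall s t : R, c <= s -> s <= t -> t <= d -> W s <= W t) /\
  forall x : R, c <= x -> x <= d -> straddle c d x (fun s t =>
    `|f t - f s - (t - s) *: g x| <= W t - W s).

(** The indefinite Henstock-Lebesgue integrals of [g], described without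
partitions. *)
Definition variational_primitive (R : realType) (E : normedModType R)
    (g : R -> E) (c d : R) (f : R -> E) : Prop :=
  forall e : R, 0 < e -> exists2 W : R -> R, controls g c d f W & W d - W c <= e.

Definition continuous_on_at (R : realType) (E : normedModType R)
    (g : R -> E) (c d x : R) : Prop :=
  forall e : R, 0 < e -> exists2 r : R, 0 < r & forall y : R, c <= y -> y <= d ->
    x - r < y -> y < x + r -> `|g y - g x| <= e.

Definition derivative_on_at (R : realType) (E : normedModType R)
    (g f : R -> E) (c d x : R) : Prop :=
  forall e : R, 0 < e -> straddle c d x (fun s t =>
    `|f t - f s - (t - s) *: g x| <= e * (t - s)).

Definition straddle_continuous (R : realType) (E : normedModType R)
    (f : R -> E) (c d x : R) : Prop :=
  forall e : R, 0 < e -> straddle c d x (fun s t => `|f t - f s| <= e).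

Section Variational.
Context {R : realType} {E : normedModType R}.
Implicit Types (c d x : R) (g f : R -> E) (W : R -> R).

Lemma straddle_scale c d x (K e : R) : 0 < e ->
  straddle c d x (fun s t => (t - s) * K <= e).
Proof.
move=> e0; have K1 : 0 < `|K| + 1 by rewrite ltr_wpDl.
exists (e / (`|K| + 1) / 2); first by rewrite !divr_gt0.
move=> s t _ _ _ _ st xs tx.
have ts : t - s <= e / (`|K| + 1) by lra.
apply: (@le_trans _ _ ((t - s) * (`|K| + 1))).
  by rewrite ler_wpM2l ?subr_ge0 ?ltW// (le_lt_trans (ler_norm K))// ltrDl.
by rewrite -ler_pdivlMr.
Qed.

Lemma subrBBC (v1 v2 w1 w2 : E) :
  v1 - v2 - (w1 - w2) = (v1 - w1) - (v2 - w2).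
Proof.
by rewrite !opprB addrACA [in RHS]addrACA; congr (_ + _); exact: addrC.
Qed.

Lemma incr_errorE f (l : E) s t :
  f t - f s - (t - s) *: l = (f t - t *: l) - (f s - s *: l).
Proof. by rewrite scalerBl subrBBC. Qed.

Lemma incr_error_split f (l : E) u v w : f w - f u - (w - u) *: l =
  (f v - f u - (v - u) *: l) + (f w - f v - (w - v) *: l).
Proof. by rewrite !incr_errorE [in RHS]addrC subrKA. Qed.

Lemma controls_sub g f W c d c' d' : c <= c' -> d' <= d ->
  controls g c d f W -> controls g c' d' f W.
Proof.
move=> cc dd [Wnd H]; split => [s t cs st td|x cx xd].
  by apply: Wnd => //; [exact: le_trans cs|exact: le_trans td _].
apply: straddle_mono (H x _ _) => //; [exact: le_trans cx|exact: le_trans xd _].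
Qed.

Lemma variational_sub g f c d c' d' : c <= c' -> c' <= d' -> d' <= d ->
  variational_primitive g c d f -> variational_primitive g c' d' f.
Proof.
move=> cc cd dd H e e0; have [W Wc We] := H e e0.
exists W; first exact: controls_sub Wc.
have [Wnd _] := Wc.
have h1 : W c <= W c' by apply: Wnd => //; exact: le_trans cd dd.
have h2 : W d' <= W d by apply: Wnd => //; exact: le_trans cc cd.
lra.
Qed.

(** On an interval where the tags have values near [l], the increment of [f] is
near the affine one. The estimate is subadditive and holds for small intervals,
without exceptional points. *)
Lemma controls_increment g f W c d (l : E) (k : R) : c < d ->
  controls g c d f W ->
  (forall x, c <= x -> x <= d -> `|g x - l| <= k) ->
  `|f d - f c - (d - c) *: l| <= k * (d - c) + (W d - W c).
Proof.
move=> cd [Wnd Wc] gl; rewrite -subr_le0.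
pose D s t := `|f t - f s - (t - s) *: l| - (k * (t - s) + (W t - W s)).
apply: (@small_subadditive R set0 D) => //.
- move=> u v w cu uv vw wd; rewrite /D.
  rewrite (incr_error_split f l u v w).
  have := ler_normD (f v - f u - (v - u) *: l) (f w - f v - (w - v) *: l).
  lra.
- move=> x cx xd _ e e0; apply: straddle_imp (Wc x cx xd).
  move=> s t cs sx xt td st H; rewrite /D.
  have -> : f t - f s - (t - s) *: l =
      (f t - f s - (t - s) *: g x) + (t - s) *: (g x - l).
    by rewrite scalerBr subrKA.
  have := ler_normD (f t - f s - (t - s) *: g x) ((t - s) *: (g x - l)).
  rewrite normrZ gtr0_norm ?subr_gt0// => H'.
  have h1 : (t - s) * `|g x - l| <= k * (t - s).
    by rewrite mulrC ler_pM2r ?subr_gt0// gl.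
  have h2 : 0 <= e * (t - s) by rewrite mulr_ge0 ?subr_ge0 ?ltW.
  lra.
Qed.

(** Two maps controlled by the same [g] have almost the same increments: their
difference is controlled by the zero map. *)
Lemma controls_diff g f f' W W' c d : c < d ->
  controls g c d f W -> controls g c d f' W' ->
  `|(f d - f c) - (f' d - f' c)| <= (W d - W c) + (W' d - W' c).
Proof.
move=> cd [Wnd Wc] [Wnd' Wc'].
have := @controls_increment (fun=> 0) (fun x => f x - f' x)
  (fun x => W x + W' x) c d 0 0 cd.
rewrite !(scaler0, subr0, mul0r, add0r) /=.
rewrite (subrBBC (f d)).
have -> : W d - W c + (W' d - W' c) = W d + W' d - (W c + W' c) by lra.
apply => [|x _ _]; last by rewrite normr0.
split => [s t cs st td|x cx xd]; first by rewrite lerD ?Wnd ?Wnd'.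
apply: straddle_imp (straddle_and (Wc x cx xd) (Wc' x cx xd)).
move=> s t cs sx xt td st [h h'] /=; rewrite scaler0 subr0.
have -> : f t - f' t - (f s - f' s) =
   (f t - f s - (t - s) *: g x) - (f' t - f' s - (t - s) *: g x).
  by rewrite (subrBBC (f t)) [RHS]subrBBC subrr subr0.
have := ler_normB (f t - f s - (t - s) *: g x) (f' t - f' s - (t - s) *: g x).
lra.
Qed.

Lemma variational_continuous g f c d x : c <= x -> x <= d ->
  variational_primitive g c d f -> straddle_continuous f c d x.
Proof.
move=> cx xd fP e e0; have e20 : 0 < e / 2 by lra.
have [W [Wnd Wc] We] := fP _ e20.
apply: straddle_imp (straddle_and (Wc x cx xd) (straddle_scale c d x `|g x| e20)).
move=> s t cs sx xt td st [h h'].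
rewrite -[f t - f s](subrK ((t - s) *: g x)).
apply: le_trans (ler_normD _ _) _.
rewrite normrZ gtr0_norm ?subr_gt0//.
have h1 : W t <= W d by apply: Wnd => //; exact: le_trans cx xt.
have h2 : W c <= W s by apply: Wnd => //; exact: le_trans sx xd.
lra.
Qed.

(** Near a continuity point [x] all tags have values close to [g x]. *)
Lemma variational_derivative g f c d x : c <= x -> x <= d ->
  variational_primitive g c d f -> continuous_on_at g c d x ->
  derivative_on_at g f c d x.
Proof.
move=> cx xd fP gx e e0; have [r r0 Hr] := gx e e0.
exists r => // s t cs sx xt td st rs rt.
apply/ler_addgt0Pr => n n0.
have [W Wc Wn] := variational_sub cs (ltW st) td fP n0.
apply: le_trans (controls_increment (k := e) st Wc _) _; last by rewrite lerD2l.
move=> y sy yt; apply: Hr; [exact: le_trans cs sy|exact: le_trans yt td|lra|lra].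
Qed.

(** The controlling function is a small multiple of [x + J x]: the first term
takes care of the points of differentiability, the jumps of [J] of the
exceptional ones. *)
Lemma derivative_variational (Z : set R) g f c d : c <= d -> countable Z ->
  (forall x, c <= x -> x <= d -> ~ Z x -> derivative_on_at g f c d x) ->
  (forall x, c <= x -> x <= d -> Z x -> straddle_continuous f c d x) ->
  variational_primitive g c d f.
Proof.
move=> cd /jump_function[J [w [Jnd J01 w0 Jw]]] Hreg Hsing e e0.
pose k := e / (d - c + 1).
have k0 : 0 < k by rewrite divr_gt0//; lra.
exists (fun x => k * x + k * J x); last first.
  rewrite (_ : _ - _ = k * (d - c + (J d - J c))); last by lra.
  rewrite /k mulrAC ler_pdivrMr; last lra.
  rewrite ler_pM2l//; have /andP[_ Jd] := J01 d; have /andP[Jc _] := J01 c; lra.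
split => [s t cs st td|x cx xd].
  by rewrite lerD// ler_pM2l// Jnd.
have [Zx|Zx] := pselect (Z x); last first.
  apply: straddle_imp (Hreg x cx xd Zx _ k0) => s t cs sx xt td st h.
  have : k * J s <= k * J t by rewrite ler_pM2l// Jnd// ltW.
  lra.
have kw0 : 0 < k * w x / 2 by rewrite divr_gt0// mulr_gt0// w0.
apply: straddle_imp (straddle_and (Hsing x cx xd Zx _ kw0)
  (straddle_scale c d x `|g x| kw0)).
move=> s t cs sx xt td st [h h'].
apply: le_trans (ler_normB _ _) _.
rewrite normrZ gtr0_norm ?subr_gt0//.
have h1 : k * w x <= k * (J t - J s) by rewrite ler_pM2l// Jw.
have h2 : k * s <= k * t by rewrite ler_pM2l// ltW.
lra.
Qed.

End Variational.

(** * Existence of variational primitives *)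

(** Only the increments of the second map enter, since primitives matter up to
constants. *)
Definition concat_at (R : realType) (V : zmodType) (v : R) (f f' : R -> V)
    (x : R) : V :=
  if x <= v then f x else f v + (f' x - f' v).

Section Existence.
Context {R : realType}.
Implicit Types c d x : R.

Lemma concat_at_le (V : zmodType) v (f f' : R -> V) x :
  x <= v -> concat_at v f f' x = f x.
Proof. by rewrite /concat_at => ->. Qed.

Lemma concat_at_ge (V : zmodType) v (f f' : R -> V) x :
  v <= x -> concat_at v f f' x = f v + (f' x - f' v).
Proof.
rewrite /concat_at le_eqVlt => /predU1P[<-|vx]; first by rewrite lexx subrr addr0.
by rewrite leNgt vx.
Qed.

Lemma concat_at_incr (V : zmodType) v (f f' : R -> V) s t : v <= s -> v <= t ->
  concat_at v f f' t - concat_at v f f' s = f' t - f' s.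
Proof.
move=> vs vt.
by rewrite !concat_at_ge// opprD addrACA subrr add0r opprB subrKA.
Qed.

Lemma concat_at_nd v (W W' : R -> R) u w : u <= v -> v <= w ->
  (forall s t, u <= s -> s <= t -> t <= v -> W s <= W t) ->
  (forall s t, v <= s -> s <= t -> t <= w -> W' s <= W' t) ->
  forall s t, u <= s -> s <= t -> t <= w -> concat_at v W W' s <= concat_at v W W' t.
Proof.
move=> uv vw nd nd' s t us st tw.
have [tv|vt] := leP t v.
  by rewrite !concat_at_le//; [exact: nd|exact: le_trans tv].
have [sv|vs] := leP s v.
  rewrite (concat_at_le _ _ sv) (concat_at_ge _ _ (ltW vt)).
  have h1 : W s <= W v by exact: nd.
  have h2 : W' v <= W' t by apply: nd' => //; exact: ltW.
  lra.
rewrite -subr_ge0 (concat_at_incr W W' (ltW vs) (ltW vt)) subr_ge0.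
by apply: nd' => //; exact: ltW.
Qed.

Section Approximation.
Context {E : normedModType R}.
Implicit Types g f : R -> E.

(** A small interval tagged by a point other than the junction stays on one side
of it; one tagged by the junction is cut there, both halves keeping the tag. *)
Lemma controls_cat g u v w f f' W W' : u < v -> v < w ->
  controls g u v f W -> controls g v w f' W' ->
  controls g u w (concat_at v f f') (concat_at v W W').
Proof.
move=> uv vw [nd H] [nd' H']; split; first by apply: concat_at_nd => //; exact: ltW.
move=> x ux xw; have [xv|vx|xv] := ltgtP x v.
- have [r r0 Hr] := straddle_and (H x ux (ltW xv))
    (straddle_near u v x (ltac:(by rewrite subr_gt0) : 0 < v - x)).
  exists (Num.min r (v - x)); first by rewrite lt_min r0 subr_gt0.
  move=> s t us sx xt tw st; rewrite ltrBlDr -ltrBlDl lt_min => /andP[h1 h2].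
  rewrite -ltrBlDl lt_min => /andP[h3 h4].
  have tv : t <= v by lra.
  rewrite !concat_at_le//; try lra.
  by have [] := Hr s t us sx xt tv st ltac:(lra) ltac:(lra).
- have [r r0 Hr] := H' x (ltW vx) xw.
  exists (Num.min r (x - v)); first by rewrite lt_min r0 subr_gt0.
  move=> s t us sx xt tw st; rewrite ltrBlDr -ltrBlDl lt_min => /andP[h1 h2].
  rewrite -ltrBlDl lt_min => /andP[h3 h4].
  rewrite !concat_at_incr; try lra.
  by apply: Hr => //; lra.
- subst x; have [r r0 Hr] := H v (ltW uv) (lexx v).
  have [r' r'0 Hr'] := H' v (lexx v) (ltW vw).
  exists (Num.min r r'); first by rewrite lt_min r0.
  move=> s t us sx xt tw st; rewrite ltrBlDr -ltrBlDl lt_min => /andP[h1 h2].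
  rewrite -ltrBlDl lt_min => /andP[h3 h4].
  have L : `|f v - f s - (v - s) *: g v| <= W v - W s.
    move: sx; rewrite le_eqVlt => /predU1P[->|sv].
      by rewrite !subrr scale0r subr0 normr0.
    by apply: Hr => //; lra.
  have L' : `|f' t - f' v - (t - v) *: g v| <= W' t - W' v.
    move: xt; rewrite le_eqVlt => /predU1P[->|vt].
      by rewrite !subrr scale0r subr0 normr0.
    by apply: Hr' => //; lra.
  rewrite (incr_error_split _ _ s v t) (concat_at_incr f f' (lexx v) xt).
  rewrite (concat_at_le f f' sx) (concat_at_le f f' (lexx v)).
  rewrite (concat_at_le W _ sx) (concat_at_ge W _ xt).
  apply: le_trans (ler_normD _ _) _; lra.
Qed.

(** Near a continuity point [x] the affine map of slope [g x] is a good
approximate primitive. Near an exceptional point a constant is one, since the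
neglected terms [(t - s) * `|g y|] are bounded by the increments of [H], up to
errors of the usual kind, and [H] varies little near this point. Interval
induction patches these local solutions. *)
Lemma dominated_approximation (Z : set R) g (H : R -> R) c d : c < d ->
  countable Z ->
  (forall x, c <= x -> x <= d -> ~ Z x -> continuous_on_at g c d x) ->
  (forall x, c <= x -> x <= d -> ~ Z x -> forall e : R, 0 < e ->
    straddle c d x (fun s t => (t - s) * `|g x| <= H t - H s + e * (t - s))) ->
  (forall s t, c <= s -> s <= t -> t <= d -> H s <= H t) ->
  (forall x, c <= x -> x <= d -> Z x -> forall e : R, 0 < e ->
    straddle c d x (fun s t => H t - H s <= e)) ->
  forall e : R, 0 < e -> exists f W, controls g c d f W /\ W d - W c <= e.
Proof.
move=> cd /jump_function[J [w [Jnd J01 w0 Jw]]] gcont gdom Hnd Hcont e e0.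
(* The weight [2] of [J] below pays once for the variation of [H] near an
   exceptional point and once for the jumps inside the controlling function. *)
pose k := e / (d - c + 1) / 2.
have k0 : 0 < k by rewrite !divr_gt0//; lra.
suff [f [W [fW We]]] : exists f W, controls g c d f W /\
    W d - W c <= k * (d - c + 2 * (J d - J c)).
  exists f, W; split => //; apply: le_trans We _.
  have /andP[_ Jd] := J01 d; have /andP[Jc _] := J01 c.
  apply: (@le_trans _ _ (k * ((d - c + 1) * 2))); first by rewrite ler_pM2l//; lra.
  by rewrite /k mulrAC mulrA mulfVK ?mulfK//; lra.
apply: (@interval_ind R (fun u v => exists f W, controls g u v f W /\
    W v - W u <= k * (v - u + 2 * (J v - J u)))) => //.
  move=> u v z cu uv vz zd [f [W [fW We]]] [f' [W' [fW' We']]].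
  exists (concat_at v f f'), (concat_at v W W'); split; first exact: controls_cat.
  rewrite (concat_at_le W _ (ltW uv)) (concat_at_ge W _ (ltW vz)); lra.
move=> x cx xd; have [Zx|Zx] := pselect (Z x); last first.
  have [r r0 Hr] := gcont x cx xd Zx _ k0.
  exists r => // u v cu ux xv vd uv ru rv.
  exists (fun y => y *: g x), (fun y => k * y); split; last first.
    rewrite -mulrBr ler_pM2l// lerDl mulr_ge0// subr_ge0; apply: Jnd; exact: ltW.
  split => [s t us st tv|y uy yv]; first by rewrite ler_pM2l.
  apply: straddleW => s t us sy yt tv st.
  rewrite -scalerBl -scalerBr normrZ gtr0_norm ?subr_gt0// -mulrBr mulrC.
  rewrite ler_pM2r ?subr_gt0// distrC; apply: Hr.
  + exact: le_trans cu uy.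
  + exact: le_trans yv vd.
  + lra.
  + lra.
have kw0 : 0 < k * w x by rewrite mulr_gt0// w0.
apply: straddle_imp (Hcont x cx xd Zx _ kw0) => u v cu ux xv vd uv Huv.
exists (fun=> 0), (fun y => H y + k * y + k * J y); split; last first.
  have : k * w x <= k * (J v - J u) by rewrite ler_pM2l// Jw.
  lra.
split => [s t us st tv|y uy yv].
  rewrite !lerD ?ler_pM2l ?Jnd//; apply: Hnd => //; lra.
have cy : c <= y by lra.
have yd : y <= d by lra.
have [Zy|Zy] := pselect (Z y); last first.
  apply: straddle_mono cu vd _ (gdom y cy yd Zy k k0) => s t us sy yt tv st h.
  rewrite subrr sub0r normrN normrZ gtr0_norm ?subr_gt0//.
  have : k * J s <= k * J t by rewrite ler_pM2l// Jnd// ltW.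
  lra.
have kwy0 : 0 < k * w y by rewrite mulr_gt0// w0.
apply: straddle_imp (straddle_scale u v y `|g y| kwy0) => s t us sy yt tv st h.
rewrite subrr sub0r normrN normrZ gtr0_norm ?subr_gt0//.
have h1 : k * w y <= k * (J t - J s) by rewrite ler_pM2l// Jw.
have h2 : k * s <= k * t by rewrite ler_pM2l// ltW.
have h3 : H s <= H t by apply: Hnd; lra.
lra.
Qed.

End Approximation.

(** The approximate primitives for the errors [(n + 1)^-1] have increments that
form uniform Cauchy sequences. *)
Lemma variational_limit (E : completeNormedModType R) (g : R -> E) c d : c < d ->
  (forall e : R, 0 < e -> exists f W, controls g c d f W /\ W d - W c <= e) ->
  exists f, variational_primitive g c d f.
Proof.
move=> cd H; pose inv (n : nat) : R := n.+1%:R^-1.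
have /choice[F HF] : forall n : nat, exists p : (R -> E) * (R -> R),
    controls g c d p.1 p.2 /\ p.2 d - p.2 c <= inv n.
  move=> n; have [f [W fW]] := H (inv n) ltac:(by rewrite invr_gt0).
  by exists (f, W).
pose phi n := (F n).1; pose W n := (F n).2.
have incr n m s t : c <= s -> s < t -> t <= d ->
    `|(phi n t - phi n s) - (phi m t - phi m s)| <= W n t - W n s + inv m.
  move=> cs st td; have [Cn _] := HF n; have [Cm Wm] := HF m.
  apply: le_trans (controls_diff st (controls_sub cs td Cn)
    (controls_sub cs td Cm)) _.
  rewrite lerD2l (le_trans _ Wm)// lerB//; case: Cm => nd _; apply: nd => //; lra.
have inv_lt (h : R) : 0 < h -> \forall n \near \oo, inv n < h.
  by move=> h0; exact: near_infty_natSinv_lt (PosNum h0).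
pose u x n := phi n x - phi n c.
have ucvg x : c <= x -> x <= d -> cvgn (u x).
  move=> cx xd.
  have uC (h : R) : 0 < h -> \forall n & m \near \oo, `|u x n - u x m| < h.
    move=> h0; have h2 : 0 < h / 2 by lra.
    near=> n m.
    have [<-|xc] := eqVneq c x; first by rewrite /u !subrr normr0.
    have cx' : c < x by rewrite lt_neqAle xc.
    apply: le_lt_trans (incr n m c x (lexx c) cx' xd) _.
    have [[nd _] Wn] := HF n; have xWd : W n x <= W n d by apply: nd.
    have hn : inv n < h / 2 by near: n; apply: inv_lt.
    have hm : inv m < h / 2 by near: m; apply: inv_lt.
    rewrite -/(W n) in Wn; lra.
  apply/cauchy_cvgP/cauchy_ballP => h h0.
  by rewrite near_map2 -ball_normE; exact: uC.
pose f x := limn (u x).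
exists f => e e0; have e2 : 0 < e / 2 by lra.
have [n hn] : exists n : nat, inv n < e / 2 :> R.
  have [n _ /(_ n (leqnn n)) /= hn] := inv_lt _ e2.
  by exists n.
have lim_incr s t : c <= s -> s < t -> t <= d ->
    `|(f t - f s) - (phi n t - phi n s)| <= W n t - W n s.
  move=> cs st td.
  have : (fun m => `|(u t m - u s m) - (phi n t - phi n s)|) @ \oo -->
      `|(f t - f s) - (phi n t - phi n s)|.
    by apply: cvg_norm; apply: cvgB; [apply: cvgB; apply: ucvg; lra|exact: cvg_cst].
  move=> L; apply/ler_addgt0Pr => h h0.
  rewrite -(cvg_lim _ L)//; apply: limr_le; first by apply/cvg_ex; eexists; exact: L.
  near=> m.
  rewrite /u /= (subrBBC (phi m t) (phi m c)) subrr subr0 distrC.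
  apply: le_trans (incr n m s t cs st td) _.
  rewrite lerD2l ltW//; near: m; apply: inv_lt; lra.
have [[nd Hn] Wn] := HF n; rewrite -/(phi n) -/(W n) in nd Hn Wn.
exists (fun x => 2 * W n x); last by rewrite /W in Wn *; lra.
split => [s t cs st td|x cx xd]; first by rewrite ler_pM2l// nd.
apply: straddle_imp (Hn x cx xd) => s t cs sx xt td st h.
have := lim_incr s t cs st td.
have := ler_normD (f t - f s - (phi n t - phi n s))
  (phi n t - phi n s - (t - s) *: g x).
rewrite subrKA; lra.
Unshelve. all: by end_near. Qed.

End Existence.

(** * Tagged partitions and Riemann integrability *)

(** Fine tagged partitions of an interval starting at [c], built from left to
right and remembered only through their right end and their error sum; this
makes prolonging a partition a single constructor. *)
Inductive fine_sum (R : realType) (err : R -> R -> R -> R) (delta : R -> R)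
    (c : R) : R -> R -> Prop :=
| fine_sum_nil : fine_sum err delta c c 0
| fine_sum_snoc s x t r : fine_sum err delta c s r ->
    s <= x -> x <= t -> s < t -> x - delta x < s -> t < x + delta x ->
    fine_sum err delta c t (r + err s x t).

Section Partitions.
Context {R : realType}.
Implicit Types (c d : R) (delta : R -> R).

Lemma itv_subset_ends (a b l r : R) : a <= b ->
  `[a, b] `<=` `]l, r[ -> l < a /\ b < r.
Proof.
move=> ab H; have := H a; have := H b; rewrite /= !in_itv /= !lexx ab /=.
by move=> /(_ isT)/andP[_ ->] /(_ isT)/andP[-> _].
Qed.

Lemma itv_subset_of_ends (a b l r : R) : l < a -> b < r ->
  `[a, b] `<=` `]l, r[.
Proof.
move=> la br y; rewrite /= !in_itv /= => /andP[ay yb].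
by rewrite (lt_le_trans la ay) (le_lt_trans yb br).
Qed.

Lemma partition_le (m : nat) (t : nat -> R) :
  (forall i, (i < m)%N -> t i < t i.+1) ->
  forall i j, (i <= j)%N -> (j <= m)%N -> t i <= t j.
Proof.
move=> tlt i j ij; rewrite -(subnKC ij); elim: (j - i)%N => [|k IH].
  by rewrite addn0.
rewrite addnS => jm; apply: le_trans (IH (ltnW jm)) (ltW (tlt _ jm)).
Qed.

Lemma fine_sum_partition err delta c x r : fine_sum err delta c x r ->
  exists m t xi, fine_tagged_partition c x delta m t xi /\
    r = \sum_(i < m) err (t i) (xi i) (t i.+1).
Proof.
elim=> [|s y z r' _ [m [t [xi [[t0 tm tlt tfine] ->]]]] sy yz sz yls zly].
  exists 0%N, (fun=> c), (fun=> c); rewrite big_ord0; split => //; split => //.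
exists m.+1, (fun i => if (i <= m)%N then t i else z),
  (fun i => if (i < m)%N then xi i else y); split.
  split => [||i|i].
  - by rewrite leq0n.
  - by rewrite ltnn.
  - rewrite ltnS => im; rewrite im; case: ifP => [im'|/negbT]; first exact: tlt.
    rewrite -leqNgt => mi; rewrite (_ : i = m) ?tm//.
    by apply/eqP; rewrite eqn_leq im.
  - rewrite ltnS => im; rewrite im; case: ifP => [im'|/negbT]; first exact: tfine.
    rewrite -leqNgt => mi; rewrite (_ : i = m) ?tm//; last first.
      by apply/eqP; rewrite eqn_leq im.
    by rewrite sy yz; split => //; exact: itv_subset_of_ends.
rewrite big_ord_recr /= leqnn !ltnn tm; congr (_ + _); apply: eq_bigr => i _.
by rewrite !ltn_ord (ltnW (ltn_ord i)).
Qed.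

(** [W x] is the supremum of the error sums over fine partitions of [[c, x]].
It is finite because every such partition can be prolonged to one of [[c, d]],
and adding one tagged interval to a partition of [[c, s]] gives the estimate. *)
Lemma partition_control (err : R -> R -> R -> R) delta (B : R) c d : c < d ->
  (forall x, c <= x -> x <= d -> 0 < delta x) ->
  (forall s x t, 0 <= err s x t) ->
  (forall m t xi, fine_tagged_partition c d delta m t xi ->
    \sum_(i < m) err (t i) (xi i) (t i.+1) <= B) ->
  exists W : R -> R, [/\
    (forall s t, c <= s -> s <= t -> t <= d -> W s <= W t),
    W d - W c <= B &
    forall s x t, c <= s -> s <= x -> x <= t -> t <= d -> s < t ->
      x - delta x < s -> t < x + delta x -> err s x t <= W t - W s].
Proof.
move=> cd d0 err0 HB; pose S x := [set r | fine_sum err delta c x r].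
have ext u v r : c <= u -> u < v -> v <= d -> S u r -> exists2 r', S v r' & r <= r'.
  move=> cu uv vd; move: r.
  apply: (@interval_ind R (fun u v => forall r, S u r ->
    exists2 r', S v r' & r <= r')) => //.
    move=> u' v' w' _ _ _ _ H1 H2 r /H1[r1 /H2[r2 Sr2 r12] rr1].
    by exists r2 => //; exact: le_trans r12.
  move=> x ux xv; exists (delta x); first by apply: d0; lra.
  move=> s t us sx xt tv st xs tx r Sr.
  by exists (r + err s x t); [exact: fine_sum_snoc|rewrite lerDl].
have Sc : S c 0 by exact: fine_sum_nil.
have ext' u v r : c <= u -> u <= v -> v <= d -> S u r ->
    exists2 r', S v r' & r <= r'.
  move=> cu; rewrite le_eqVlt => /predU1P[<- _|uv vd]; last exact: ext.
  by exists r.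
have Sne x : c <= x -> x <= d -> S x !=set0.
  by move=> cx xd; have [r Sr _] := ext' c x 0 (lexx c) cx xd Sc; exists r.
have Sd r : S d r -> r <= B.
  by move=> /fine_sum_partition[m [t [xi [H ->]]]]; exact: HB.
have SB x r : c <= x -> x <= d -> S x r -> r <= B.
  move=> cx xd /(ext' _ _ _ cx xd (lexx d))[r' /Sd r'B rr'].
  exact: le_trans r'B.
have Sub x : c <= x -> x <= d -> has_ubound (S x).
  by move=> cx xd; exists B => r; exact: SB.
exists (fun x => sup (S x)); split.
- move=> s t cs st td; have sd := le_trans st td; have ct := le_trans cs st.
  apply: ge_sup; first exact: Sne.
  move=> r /(ext' _ _ _ cs st td)[r' Sr' /le_trans]; apply.
  by apply: ub_le_sup => //; exact: Sub.
- have h1 : sup (S d) <= B by apply: ge_sup => //; apply: Sne => //; exact: ltW.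
  have h2 : 0 <= sup (S c) by apply: ub_le_sup => //; apply: Sub => //; exact: ltW.
  lra.
- move=> s x t cs sx xt td st xs tx.
  have sd := le_trans (ltW st) td; have ct := le_trans cs (ltW st).
  suff : sup (S s) <= sup (S t) - err s x t by lra.
  apply: ge_sup; first exact: Sne.
  move=> r Sr; rewrite lerBrDr; apply: ub_le_sup; first exact: Sub.
  exact: fine_sum_snoc.
Qed.

Lemma telescope_partition (W : R -> R) m (t : nat -> R) :
  \sum_(i < m) (W (t i.+1) - W (t i)) = W (t m) - W (t 0%N).
Proof.
elim: m => [|m IH]; first by rewrite big_ord0 subrr.
by rewrite big_ord_recr /= IH addrC subrKA.
Qed.

Lemma fine_partition_facts c d delta m t xi i :
  fine_tagged_partition c d delta m t xi -> (i < m)%N ->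
  [/\ c <= t i, t i < t i.+1, t i.+1 <= d & t i <= xi i <= t i.+1] /\
  xi i - delta (xi i) < t i /\ t i.+1 < xi i + delta (xi i).
Proof.
move=> [<- <- tlt tfine] im; have [txi tsub] := tfine i im.
have mono := partition_le tlt; split.
  by split => //; [apply: mono => //; exact: ltnW|exact: tlt|exact: mono].
by apply: itv_subset_ends => //; exact/ltW/tlt.
Qed.

Section Vector.
Context {E : normedModType R}.
Implicit Types g f : R -> E.

Lemma variational_HL g f c d :
  variational_primitive g c d f -> HL_integrable g c d.
Proof.
move=> fP; exists f => e e0; have e2 : 0 < e / 2 by lra.
have [W [Wnd HW] We] := fP _ e2.
have /choice[delta Hd] : forall x, exists r : R, c <= x -> x <= d -> 0 < r /\
    forall s t, c <= s -> s <= x -> x <= t -> t <= d -> s < t ->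
      x - r < s -> t < x + r -> `|f t - f s - (t - s) *: g x| <= W t - W s.
  move=> x; have [/andP[cx xd]|H] := boolP ((c <= x) && (x <= d)).
    by have [r r0 H] := HW x cx xd; exists r.
  by exists 0 => cx xd; rewrite cx xd in H.
exists delta; split.
  by move=> x; rewrite in_itv /= => /andP[cx xd]; have [] := Hd x cx xd.
move=> m t xi P; apply: (@le_lt_trans _ _ (W d - W c)); last by lra.
have [t0 tm _ _] := P.
rewrite -t0 -tm -(telescope_partition W); apply: ler_sum => i _.
have [[h1 h2 h3 /andP[h4 h5]] [h6 h7]] := fine_partition_facts P (ltn_ord i).
by have [||_] := Hd (xi i); [lra|lra|apply].
Qed.

Lemma HL_variational g c d : c < d -> HL_integrable g c d ->
  exists f, variational_primitive g c d f.
Proof.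
move=> cd [f Hf]; exists f => e e0; have [delta [d0 H]] := Hf e e0.
have d0' x : c <= x -> x <= d -> 0 < delta x.
  by move=> cx xd; apply: d0; rewrite in_itv /= cx.
have [] := @partition_control (fun s x t => `|f t - f s - (t - s) *: g x|)
  delta e c d cd d0'; first by [].
  by move=> m t xi P; exact/ltW/H.
move=> W [nd We HW]; exists W => //; split => // x cx xd.
exists (delta x); first exact: d0'.
by move=> s t cs sx xt td st xs tx; apply: HW.
Qed.

(** For [g = 0] the error sums are the sums defining the total variation of [f],
which absolute continuity makes finite on short intervals. *)
Lemma absolutely_continuous_variation f c d : absolutely_continuous f c d ->
  exists2 r : R, 0 < r & forall u v, c <= u -> u < v -> v <= d -> v - u < r ->
    exists V : R -> R, V v - V u <= 1 /\
      forall s t, u <= s -> s < t -> t <= v -> `|f t - f s| <= V t - V s.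
Proof.
move=> /(_ 1 ltr01)[r [r0 H]]; exists r => // u v cu uv vd vur.
have [] := @partition_control (fun s x t => `|f t - f s|)
  (fun=> v - u + 1) 1 u v uv; [by move=> *; lra|by []| |].
  move=> m t xi P; apply/ltW; have [t0 tm tlt _] := P.
  have mono := partition_le tlt.
  apply: (H m (fun i => t i) (fun i => t i.+1)).
  - move=> i; have [[h1 h2 h3 _] _] := fine_partition_facts P (ltn_ord i).
    by split; lra.
  - apply/trivIsetP => i j _ _; wlog ij : i j / (i < j)%N.
      move=> W ne; have [ij|ji|/val_inj ij] := ltngtP i j; first exact: W.
        by rewrite setIC; apply: W => //; rewrite eq_sym.
      by rewrite ij eqxx in ne.
    move=> _; apply/seteqP; split => // y [] /=; rewrite !in_itv /=.
    move=> /andP[_ h1] /andP[h2 _]; have := mono _ _ ij (ltnW (ltn_ord j)).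
    lra.
  - by rewrite (telescope_partition id) t0 tm.
move=> V [nd V1 HV]; exists V; split => // s t us st tv.
apply: (HV s s t) => //; [exact: ltW|lra|lra].
Qed.

Lemma variational_increment g f c d (l : E) (k : R) : c < d ->
  variational_primitive g c d f ->
  (forall x, c <= x -> x <= d -> `|g x - l| <= k) ->
  `|f d - f c - (d - c) *: l| <= k * (d - c).
Proof.
move=> cd fP gl; apply/ler_addgt0Pr => n n0; have [W Wc Wn] := fP n n0.
by apply: le_trans (controls_increment cd Wc gl) _; rewrite lerD2l.
Qed.

(** As opposed to [controls], the length of the controlled intervals is bounded
below independently of the tag, as Riemann integrability requires. *)
Definition uniformly_controls g u v f (W : R -> R) : Prop :=
  (forall s t : R, u <= s -> s <= t -> t <= v -> W s <= W t) /\
  exists2 r : R, 0 < r & forall s x t : R, u <= s -> s <= x -> x <= t -> t <= v ->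
    s < t -> t - s < r -> `|f t - f s - (t - s) *: g x| <= W t - W s.

(** A short interval that straddles the junction [v] may have its tag anywhere.
Its error is at most [K * (t - s)], so a term that increases with slope [K] close
to [v] is added to the controlling function; its total increase can be made
smaller than any [h]. *)
Lemma uniformly_controls_cat g f (W W' : R -> R) (K h : R) u v w :
  u < v -> v < w -> 0 <= K -> 0 < h ->
  (forall s x t, u <= s -> s <= x -> x <= t -> t <= w -> s < t ->
    `|f t - f s - (t - s) *: g x| <= K * (t - s)) ->
  uniformly_controls g u v f W -> uniformly_controls g v w f W' ->
  exists2 W'' : R -> R, uniformly_controls g u w f W'' &
    W'' w - W'' u <= (W v - W u) + (W' w - W' v) + h.
Proof.
move=> uv vw K0 h0 errK [nd [r r0 HW]] [nd' [r' r'0 HW']].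
(* The additional increase is at most [2 * K * rho]; the summand [1] avoids a
   division by zero. *)
pose rho : R := Num.min (Num.min r r') (h / (2 * (K + 1))).
have K1 : 0 < 2 * (K + 1) by lra.
have rho0 : 0 < rho by rewrite !lt_min r0 r'0 divr_gt0.
have rhor : rho <= r by rewrite /rho !ge_min lexx.
have rhor' : rho <= r' by rewrite /rho !ge_min lexx orbT.
have rhoh : K * (2 * rho) <= h.
  apply: (@le_trans _ _ (rho * (2 * (K + 1)))); first by lra.
  by rewrite -ler_pdivlMr// /rho ge_min lexx orbT.
clearbody rho; clear r0 r'0 K1 h0.
(* [cl] is the identity near [v] and constant elsewhere: it charges the
   intervals that may straddle [v]. *)
pose cl (y : R) : R := Num.max (v - rho) (Num.min y (v + rho)).
have cl_nd s t : s <= t -> cl s <= cl t.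
  move=> st; rewrite /cl ge_max le_max lexx /= le_max; apply/orP; right.
  by rewrite le_min !ge_min st lexx orbT.
have cl_range : cl w - cl u <= 2 * rho.
  have : v - rho <= cl u by rewrite /cl le_max lexx.
  have : cl w <= v + rho by rewrite /cl ge_max ge_min lexx orbT andbT; lra.
  lra.
have cl_id y : v - rho <= y -> y <= v + rho -> cl y = y.
  by move=> h1 h2; rewrite /cl (min_idPl h2) (max_idPr h1).
clearbody cl.
have cat_nd := concat_at_nd (ltW uv) (ltW vw) nd nd'.
exists (fun y => concat_at v W W' y + K * cl y); last first.
  rewrite (concat_at_le W _ (ltW uv)) (concat_at_ge W _ (ltW vw)).
  by have := ler_wpM2l K0 cl_range; lra.
split=> [s t us st tw|].
  by rewrite lerD ?cat_nd// ler_wpM2l// cl_nd.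
exists rho => // s x t us sx xt tw st tsr.
have clst : 0 <= K * (cl t - cl s) by rewrite mulr_ge0// subr_ge0 cl_nd// ltW.
have [tv|vt] := leP t v.
  have := HW s x t us sx xt tv st (lt_le_trans tsr rhor).
  rewrite (concat_at_le W _ tv) (concat_at_le W _ (le_trans (ltW st) tv)).
  by move: clst; clear; lra.
have [vs|sv] := leP v s.
  have := HW' s x t vs sx xt tw st (lt_le_trans tsr rhor').
  have := concat_at_incr W W' vs (ltW vt).
  by move: clst; clear; lra.
have := cat_nd s t us (ltW st) tw.
have := errK s x t us sx xt tw st.
have -> : cl t = t by apply: cl_id; move: sv vt tsr; clear -rho0; lra.
have -> : cl s = s by apply: cl_id; move: sv vt tsr; clear -rho0; lra.
by clear; lra.
Qed.

(** For bounded [g] the error over [[s, t]] is at most [2 * M * (t - s)] whatever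
the tag is, which settles the neighbourhoods of exceptional points. The strict
inequality carried through the interval induction leaves room for the small
losses at the junctions. *)
Lemma bounded_uniform_control (Z : set R) g f (M : R) c d : c < d -> countable Z ->
  variational_primitive g c d f ->
  (forall x, c <= x -> x <= d -> `|g x| <= M) ->
  (forall x, c <= x -> x <= d -> ~ Z x -> continuous_on_at g c d x) ->
  forall e : R, 0 < e ->
    exists2 W : R -> R, uniformly_controls g c d f W & W d - W c < e.
Proof.
move=> cd /jump_function[J [w [Jnd J01 w0 Jw]]] fP gM gcont e e0.
have M0 : 0 <= M by apply: le_trans (gM c (lexx c) (ltW cd)).
have errM s x t : c <= s -> s <= x -> x <= t -> t <= d -> s < t ->
    `|f t - f s - (t - s) *: g x| <= 2 * M * (t - s).
  move=> cs sx xt td st; apply: variational_increment => //.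
    exact: variational_sub cs (ltW st) td fP.
  move=> y sy yt; apply: le_trans (ler_normB _ _) _.
  have := gM y (le_trans cs sy) (le_trans yt td).
  have := gM x (le_trans cs sx) (le_trans xt td).
  by clear; lra.
pose k := e / (d - c + 1).
have k0 : 0 < k by rewrite divr_gt0//; lra.
suff [W HW We] : exists2 W : R -> R, uniformly_controls g c d f W &
    W d - W c < k * (d - c + (J d - J c)).
  exists W => //; apply: lt_le_trans We _; rewrite /k mulrAC ler_pdivrMr; last lra.
  by rewrite ler_pM2l//; have /andP[_ Jd] := J01 d; have /andP[Jc _] := J01 c; lra.
have M20 : 0 <= 2 * M by rewrite mulr_ge0.
apply: (@interval_ind R (fun u v => exists2 W : R -> R,
    uniformly_controls g u v f W & W v - W u < k * (v - u + (J v - J u)))) => //.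
  move=> u v z cu uv vz zd [W HW We] [W' HW' We'].
  pose h := k * (z - u + (J z - J u)) - (W v - W u + (W' z - W' v)).
  have h20 : 0 < h / 2 by rewrite /h; move: We We'; clear; lra.
  have [|W'' HW'' We''] := uniformly_controls_cat uv vz M20 h20 _ HW HW'.
    move=> s x t us sx xt tz.
    exact: errM (le_trans cu us) sx xt (le_trans tz zd).
  by exists W'' => //; move: h20 We''; rewrite /h; clear; lra.
move=> x cx xd; have [Zx|Zx] := pselect (Z x); last first.
  have [r r0 Hr] := gcont x cx xd Zx (k / 4) ltac:(lra).
  exists r => // u v cu ux xv vd uv ru rv.
  exists (fun y => k / 2 * y); last first.
    have h1 : 0 <= k * (J v - J u).
      by rewrite mulr_ge0 ?(ltW k0)// subr_ge0 Jnd// ltW.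
    have h2 : 0 < k * (v - u) by rewrite mulr_gt0// subr_gt0.
    by move: h1 h2; clear; lra.
  split; first by move=> s t us st tv; rewrite ler_pM2l//; move: k0; clear; lra.
  have Hx z : u <= z -> z <= v -> `|g z - g x| <= k / 4.
    move=> uz zv; apply: Hr; [exact: le_trans uz|exact: le_trans vd|
      exact: lt_le_trans uz|exact: le_lt_trans rv].
  exists 1 => // s y t us sy yt tv st _; rewrite -mulrBr.
  apply: variational_increment => //.
    exact: variational_sub (le_trans cu us) (ltW st) (le_trans tv vd) fP.
  move=> z sz zt; rewrite -(subrKA (g x)); apply: le_trans (ler_normD _ _) _.
  have := Hx z (le_trans us sz) (le_trans zt tv).
  have := Hx y (le_trans us sy) (le_trans yt tv).
  by rewrite [`|g x - g y|]distrC; clear; lra.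
have kw0 : 0 < k * w x / 2 by rewrite divr_gt0// mulr_gt0// w0.
apply: straddle_imp (straddle_scale c d x (2 * M) kw0).
move=> u v cu ux xv vd uv Huv; exists (fun y => 2 * M * y); last first.
  have h1 : k * w x <= k * (J v - J u) by rewrite ler_pM2l// Jw.
  have h2 : 0 < k * (v - u) by rewrite mulr_gt0// subr_gt0.
  by move: h1 h2 Huv kw0; clear; lra.
split; first by move=> s t us st tv; rewrite ler_wpM2l.
exists 1 => // s y t us sy yt tv st _; rewrite -mulrBr.
exact: errM (le_trans cu us) sy yt (le_trans tv vd) st.
Qed.

Lemma bounded_Riemann (Z : set R) g f (M : R) c d : c < d -> countable Z ->
  variational_primitive g c d f ->
  (forall x, c <= x -> x <= d -> `|g x| <= M) ->
  (forall x, c <= x -> x <= d -> ~ Z x -> continuous_on_at g c d x) ->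
  Riemann_integrable g c d.
Proof.
move=> cd Zc fP gM gcont; exists f => e e0.
have [W [_ [r r0 HW]] We] := bounded_uniform_control cd Zc fP gM gcont e0.
exists (r / 2); split; first by lra.
move=> m t xi P; apply: le_lt_trans (ler_norm_sum _ _ _) _.
apply: le_lt_trans We; have [t0 tm _ _] := P.
rewrite -t0 -tm -(telescope_partition W); apply: ler_sum => i _.
have [[h1 h2 h3 /andP[h4 h5]] [h6 h7]] := fine_partition_facts P (ltn_ord i).
by apply: HW => //; lra.
Qed.

(** Two Riemann sums over the same fine partition that differ in one tag are
close to the same increment of [f], hence to each other; this bounds the
difference of the values of [g] at both tags. *)
Lemma Riemann_bounded g c d : c < d -> Riemann_integrable g c d ->
  exists M : R, forall x, c <= x -> x <= d -> `|g x| <= M.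
Proof.
move=> cd [f /(_ 1 ltr01)[delta [delta0 H]]].
pose N := (Num.truncn ((d - c) / delta)).+1.
have N0 : 0 < N%:R :> R by rewrite ltr0n.
pose h := (d - c) / N%:R.
have h0 : 0 < h by rewrite divr_gt0// subr_gt0.
have hd : h < delta.
  by rewrite /h ltr_pdivrMr// mulrC -ltr_pdivrMr// /N truncnS_gt.
pose t (i : nat) := c + i%:R * h.
have tS i : t i.+1 = t i + h by rewrite /t -natr1 mulrDl mul1r addrA.
have tN : t N = d by rewrite /t /h mulrC divfK ?gt_eqF// addrC subrK.
have t0 : t 0%N = c by rewrite /t mul0r addr0.
have find m x : c <= x -> x <= t m.+1 ->
    exists2 k, (k <= m)%N & t k <= x <= t k.+1.
  elim: m => [|m IH] cx xt; first by exists 0%N; rewrite // t0 cx.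
  have [xm|mx] := leP x (t m.+1).
    by have [k km kx] := IH cx xm; exists k => //; exact: leqW.
  by exists m.+1 => //; rewrite (ltW mx).
have part xi : (forall i, (i < N)%N -> t i <= xi i <= t i.+1) ->
    fine_tagged_partition c d (fun=> delta) N t xi.
  move=> Hxi; split => // i iN; first by rewrite tS ltrDl.
  split; first exact: Hxi.
  by have /andP[] := Hxi i iN; rewrite tS => h1 h2; apply: itv_subset_of_ends; lra.
have base i : (i < N)%N -> t i <= t i <= t i.+1.
  by move=> _; rewrite lexx tS lerDl ltW.
exists (2 / h + \sum_(i < N) `|g (t i)|) => x cx xd.
have [k kN kx] := find N.-1 x cx ltac:(by rewrite tN).
have kN' : (k < N)%N by [].
(* Moving the tag of the cell that contains [x] from its left end to [x]. *)
pose xi i := if i == k then x else t i.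
have Hxi i : (i < N)%N -> t i <= xi i <= t i.+1.
  by rewrite /xi; case: eqP => [->//|_]; exact: base.
have H1 := H N t t (part _ base); have H2 := H N t xi (part _ Hxi).
have : `|h *: (g x - g (t k))| < 2.
  have -> : h *: (g x - g (t k)) =
     \sum_(i < N) (f (t i.+1) - f (t i) - (t i.+1 - t i) *: g (t i)) -
     \sum_(i < N) (f (t i.+1) - f (t i) - (t i.+1 - t i) *: g (xi i)).
    rewrite -sumrB (bigD1 (Ordinal kN'))//= big1 => [|i /eqP ik].
      rewrite addr0 /xi eqxx tS [_ + h]addrC addrK.
      by rewrite subrBBC subrr sub0r opprB scalerBr.
    rewrite /xi ifN ?subrr//; apply/eqP => ik'; apply: ik; exact: val_inj.
  apply: le_lt_trans (ler_normB _ _) _; lra.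
rewrite normrZ gtr0_norm// mulrC -ltr_pdivlMr// => Hx.
have : `|g (t k)| <= \sum_(i < N) `|g (t i)|.
  by rewrite (bigD1 (Ordinal kN'))//= lerDl sumr_ge0.
have := ler_normD (g x - g (t k)) (g (t k)); rewrite subrK; lra.
Qed.

(** * Discontinuities of maps with right limits *)

(** A point at which the oscillation is at least [(n + 1)^-1] is followed by an
open interval of smaller oscillation, which contains no other such point. These
intervals are disjoint, so that there are only countably many of them. *)
Lemma right_limits_discontinuities (D : set R) g :
  (forall t, D t -> exists l : E, g x @[x --> t^'+] --> l) ->
  countable [set t | D t /\ ~ {for t, continuous g}].
Proof.
move=> Dg.
pose A (n : nat) := [set t | D t /\ forall s r, s < t -> t < r ->
  exists x y, [/\ s < x, x < r, s < y, y < r & n.+1%:R^-1 <= `|g x - g y|]].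
apply: (@sub_countable _ _ _ (\bigcup_n A n)).
  apply: subset_card_le => t [Dt ncont]; apply: contrapT => nA; apply: ncont.
  apply/cvgrPdist_lt => e e0.
  have [n _ /(_ n (leqnn n)) /= ne] := near_infty_natSinv_lt (PosNum e0).
  have [s [r [st tr Hsr]]] : exists s r, [/\ s < t, t < r & forall x y,
      s < x -> x < r -> s < y -> y < r -> `|g x - g y| < n.+1%:R^-1].
    apply: contrapT => H; apply: nA; exists n => //; split => // s r st tr.
    apply: contrapT => H'; apply: H; exists s, r; split => // x y sx xr sy yr.
    by rewrite ltNge; apply/negP => H''; apply: H'; exists x, y.
  near=> x; apply: lt_trans ne; apply: Hsr => //; near: x.
    exact: lt_nbhsr.
  exact: lt_nbhsl.
apply: bigcup_countable => // n _.
have /choice[r Hr] : forall t, exists r, t < r /\ (D t -> forall x y,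
    t < x -> x < r -> t < y -> y < r -> `|g x - g y| < n.+1%:R^-1).
  move=> t; have [Dt|nDt] := pselect (D t); last first.
    by exists (t + 1); split => //; rewrite ltrDl.
  have [l /cvgrPdist_lt /(_ (n.+1%:R^-1 / 2))] := Dg t Dt.
  case; first by rewrite divr_gt0.
  move=> d /= d0 Hd; exists (t + d); split; first by rewrite ltrDl.
  move=> _ x y tx xd ty yd.
  have Hx : `|l - g x| < n.+1%:R^-1 / 2.
    by apply: Hd => //=; rewrite distrC gtr0_norm ?subr_gt0//; lra.
  have Hy : `|l - g y| < n.+1%:R^-1 / 2.
    by apply: Hd => //=; rewrite distrC gtr0_norm ?subr_gt0//; lra.
  rewrite -(subrKA l); apply: le_lt_trans (ler_normD _ _) _.
  by rewrite [`|g x - l|]distrC [ltRHS]splitr ltrD.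
apply: (@separated_open_countable R _ (fun t => `]t, r t[%classic)).
- by move=> t; exact: itv_open.
- move=> t; exists ((t + r t) / 2); rewrite /= in_itv /=.
  by have [tr _] := Hr t; apply/andP; split; lra.
apply/trivIsetP => s t [Ds As] [Dt At]; wlog st : s t Ds As Dt At / s < t.
  move=> W ne; have [st|ts|st] := ltgtP s t; first exact: W.
    by rewrite setIC; apply: W => //; rewrite eq_sym.
  by rewrite st eqxx in ne.
move=> _; apply/seteqP; split => // y [] /=; rewrite !in_itv /=.
move=> /andP[_ yr] /andP[ty _]; have [_ /(_ Ds) H] := Hr s.
have [x [z [sx xr sz zr]]] := At s (r s) st (lt_trans ty yr).
by rewrite leNgt H.
Unshelve. all: by end_near. Qed.

End Vector.
End Partitions.

(** * CD primitives on a half-open interval *)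

Definition half_open (R : realType) (a : R) (b : \bar R) : set R :=
  [set t | a <= t /\ (t%:E < b)%E].

Section HalfOpen.
Context {R : realType}.
Variables (a : R) (b : \bar R).
Local Notation J := (half_open a b).

Lemma half_open_itv c d : J c -> J d -> `[c, d] `<=` J.
Proof.
move=> [ac _] [_ db] t; rewrite /= in_itv /= => /andP[ct td].
by split; [exact: le_trans ct|apply: le_lt_trans db; rewrite lee_fin].
Qed.

Lemma half_open_next t : J t -> exists2 d, J d & t < d.
Proof.
move=> [at_ tb]; case: b tb => [r| |//] tb.
  rewrite lte_fin in tb; exists ((t + r) / 2); last by lra.
  by split; [lra|rewrite lte_fin; lra].
exists (t + 1); last by lra.
by split; [lra|exact: ltry].
Qed.

End HalfOpen.

Section Pointwise.
Context {R : realType} {E : normedModType R}.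
Implicit Types (f g : R -> E) (J : set R).

Lemma continuous_continuous_on_at g c d x :
  {for x, continuous g} -> continuous_on_at g c d x.
Proof.
move=> /cvgrPdist_le H e e0; have [r /= r0 Hr] := H e e0.
exists r => // y _ _ xy yx; rewrite distrC; apply: Hr => /=.
by rewrite ltr_norml; apply/andP; split; lra.
Qed.

Lemma within_straddle_continuous J f c d x : `[c, d] `<=` J -> c <= x -> x <= d ->
  {within J, continuous f} -> straddle_continuous f c d x.
Proof.
move=> cdJ cx xd /subspace_continuousP fc e e0.
have Jx : J x by apply: cdJ; rewrite /= in_itv /= cx.
have e2 : 0 < e / 2 by lra.
have /cvgrPdist_le/(_ _ e2) := fc x Jx.
move=> [r /= r0 Hr]; exists r => // s t cs sx xt td st xs tx.
have Hy y : c <= y -> y <= d -> x - r < y -> y < x + r -> `|f x - f y| <= e / 2.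
  move=> cy yd xy yx; apply: (Hr y) => /=.
    by rewrite ltr_norml; apply/andP; split; lra.
  by apply: cdJ; rewrite /= in_itv /= cy.
have := Hy s cs ltac:(lra) xs ltac:(lra).
have := Hy t ltac:(lra) td ltac:(lra) tx.
have := ler_distD (f x) (f t) (f s); rewrite [`|f t - f x|]distrC; lra.
Qed.

(** The left end [c] may depend on the point, but must not exclude any point of
[J] below [d]: the intervals in [[c, d]] have to see all of [J] near [x]. *)
Lemma straddle_continuous_within J f :
  (forall x, J x -> exists c d, [/\ c <= x, x < d,
     forall y, J y -> y <= d -> c <= y & straddle_continuous f c d x]) ->
  {within J, continuous f}.
Proof.
move=> H; apply/subspace_continuousP => x Jx.
have [c [d [cx xd Jc fc]]] := H x Jx.
apply/cvgrPdist_le => e e0; have [r r0 Hr] := fc e e0.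
exists (Num.min r (d - x)); first by rewrite /= lt_min r0 subr_gt0.
move=> y /=; rewrite lt_min !ltr_norml => /andP[/andP[h1 h2] /andP[h3 h4]] Jy.
have cy : c <= y by apply: Jc => //; lra.
have [yx|xy|->] := ltgtP y x; last by rewrite subrr normr0 ltW.
  by apply: Hr => //; lra.
by rewrite distrC; apply: Hr => //; lra.
Qed.

Lemma is_derive_derivative_on_at g f c d (x : R) :
  is_derive x 1 f (g x) -> derivative_on_at g f c d x.
Proof.
move=> [df dfE] e e0; rewrite /derivable in df; rewrite /derive in dfE.
have {df} : (fun h => h^-1 *: ((f \o shift x) (h *: (1 : R)) - f x)) @ 0^'
    --> g x by rewrite -dfE; exact: df.
move=> /cvgrPdist_le/(_ e e0)[r /= r0 Hr].
have err h : `|h| < r -> `|f (x + h) - f x - h *: g x| <= e * `|h|.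
  move=> hr; have [->|h0] := eqVneq h 0.
    by rewrite addr0 scale0r subrr subr0 !normr0 mulr0.
  have := Hr h; rewrite /= sub0r normrN => /(_ hr h0).
  have -> : h *: (1 : R) + x = x + h by rewrite addrC; congr (_ + _); exact: mulr1.
  rewrite -(ler_pM2l (_ : 0 < `|h|)) ?normr_gt0// -normrZ scalerBr scalerA.
  by rewrite mulfV// scale1r distrC mulrC.
exists r => // s t cs sx xt td st xs tx.
rewrite (incr_error_split f (g x) s x t).
have h1 := err (t - x) ltac:(rewrite ltr_norml; apply/andP; split; lra).
have h2 := err (s - x) ltac:(rewrite ltr_norml; apply/andP; split; lra).
rewrite subrKC ger0_norm ?subr_ge0// in h1.
rewrite subrKC ler0_norm ?subr_le0// opprB in h2.
have {}h2 : `|f x - f s - (x - s) *: g x| <= e * (x - s).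
  by rewrite incr_errorE -opprB normrN -incr_errorE.
apply: le_trans (ler_normD _ _) _; lra.
Qed.

Lemma derivative_on_at_is_derive g f c d (x : R) : c < x -> x < d ->
  derivative_on_at g f c d x -> is_derive x 1 f (g x).
Proof.
move=> cx xd H.
suff L : (fun h => h^-1 *: ((f \o shift x) (h *: (1 : R)) - f x)) @ 0^' --> g x.
  by split; [apply/cvg_ex; exists (g x)|exact: cvg_lim L].
apply/cvgrPdist_le => e e0; have [r r0 Hr] := H e e0.
exists (Num.min r (Num.min (x - c) (d - x))).
  by rewrite /= !lt_min r0 !subr_gt0 cx.
move=> h /=; rewrite sub0r normrN !lt_min !ltr_norml.
move=> /and3P[/andP[h1 h2] /andP[h3 h4] /andP[h5 h6]] h0.
have -> : h *: (1 : R) + x = x + h by rewrite addrC; congr (_ + _); exact: mulr1.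
rewrite -(ler_pM2l (_ : 0 < `|h|)) ?normr_gt0// -normrZ scalerBr scalerA.
rewrite mulfV// scale1r distrC mulrC.
have [hneg|hpos|hE] := ltgtP h 0; last by rewrite hE eqxx in h0.
  rewrite ltr0_norm//.
  have := Hr (x + h) x ltac:(lra) ltac:(lra) (lexx x) (ltW xd) ltac:(lra)
    ltac:(lra) ltac:(lra).
  by rewrite opprD addrA subrr add0r scaleNr opprK -[f x - _]opprB -normrN
    opprD opprK.
rewrite gtr0_norm//.
have := Hr x (x + h) (ltW cx) (lexx x) ltac:(lra) ltac:(lra) ltac:(lra)
  ltac:(lra) ltac:(lra).
by rewrite [x + h - x]addrC addKr.
Qed.

End Pointwise.

Section Gluing.
Context {R : realType} {E : normedModType R}.
Implicit Types (f g : R -> E).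

Lemma variational_unique g f f' c d : c < d -> variational_primitive g c d f ->
  variational_primitive g c d f' -> f d - f c = f' d - f' c.
Proof.
move=> cd fP fP'; apply/eqP; rewrite -subr_eq0 -normr_le0.
apply/ler_addgt0Pr => e e0; rewrite add0r; have e2 : 0 < e / 2 by lra.
have [W Wc We] := fP _ e2; have [W' Wc' We'] := fP' _ e2.
apply: le_trans (controls_diff cd Wc Wc') _; lra.
Qed.

Lemma eq_variational g f f' c d :
  (forall s t, c <= s -> s < t -> t <= d -> f t - f s = f' t - f' s) ->
  variational_primitive g c d f -> variational_primitive g c d f'.
Proof.
move=> ff' fP e e0; have [W [nd HW] We] := fP e e0; exists W => //; split => //.
move=> x cx xd; apply: straddle_imp (HW x cx xd) => s t cs sx xt td st.
by rewrite ff'.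
Qed.

(** Primitives are unique up to a constant, so the one on [[a, t]] normalized at
[a] has at [t] the value of every other normalized one. *)
Lemma variational_exhaust g a b :
  (forall d, half_open a b d -> a < d -> exists f, variational_primitive g a d f) ->
  exists f, forall d, half_open a b d -> a < d -> variational_primitive g a d f.
Proof.
move=> H; have /choice[F HF] : forall d, exists f : R -> E,
    half_open a b d -> a < d -> variational_primitive g a d f.
  move=> d; have [[Jd ad]|nd] := pselect (half_open a b d /\ a < d).
    by have [f fP] := H d Jd ad; exists f.
  by exists (fun=> 0) => Jd ad; case: nd.
pose f t := if a < t then F t t - F t a else 0.
have fE d t : half_open a b d -> a < d -> a <= t -> t <= d ->
    f t = F d t - F d a.
  move=> Jd ad at_ td; rewrite /f; case: ltP => [at'|ta]; last first.
    by rewrite (_ : t = a) ?subrr//; apply/eqP; rewrite eq_le ta.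
  have Jt : half_open a b t.
    by case: Jd => _ db; split => //; apply: le_lt_trans db; rewrite lee_fin.
  apply: variational_unique at' (HF t Jt at') _.
  exact: variational_sub (lexx a) at_ td (HF d Jd ad).
exists f => d Jd ad; apply: eq_variational (HF d Jd ad) => s t as_ st td.
rewrite (fE d t Jd ad ltac:(lra) td) (fE d s Jd ad as_ ltac:(lra)).
by rewrite opprB addrA subrK.
Qed.

End Gluing.

Lemma sup_removedE (R : realType) (I : set (\bar R)) (a : R) :
  ereal_interval I -> I a%:E -> lbound I a%:E ->
  sup_removed I = half_open a (ereal_sup I).
Proof.
move=> itvI Ia aI; apply/seteqP; split => t /= [].
  move=> It tsup; split; first by have := aI _ It; rewrite lee_fin.
  by rewrite lt_neqAle; apply/andP; split; [exact/eqP|exact: ereal_sup_ubound].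
move=> at_ tsup; split; last by move=> tE; rewrite tE ltxx in tsup.
have [y Iy ty] := ereal_sup_gt tsup.
by apply: itvI Ia Iy _ (ltW ty); rewrite lee_fin.
Qed.

Lemma countable_setU (T : Type) (A B : set T) :
  countable A -> countable B -> countable (A `|` B).
Proof.
by move=> Ac Bc; rewrite -bigcup2E; apply: bigcup_countable => // -[|[|i]].
Qed.

Lemma countable_preimage_inj (T U : Type) (h : T -> U) (A : set U) :
  injective h -> countable A -> countable (h @^-1` A).
Proof.
move=> hI /countable_injP[n nI]; apply/countable_injP; exists (n \o h).
move=> x y /set_mem Ax /set_mem Ay /= /nI E.
by apply: hI; apply: E; apply: mem_set.
Qed.

Section Interval.
Context {R : realType} {E : normedModType R}.
Variables (I : set (\bar R)) (a : R) (g : \bar R -> E).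
Hypotheses (I_interval : ereal_interval I) (Ia : I a%:E) (aI : lbound I a%:E)
  (a_lt_sup : (a%:E < ereal_sup I)%E) (g_reg : right_regulated I g).
Local Notation gR := (fun t : R => g t%:E).
Local Notation J := (sup_removed I).
Let JE : J = half_open a (ereal_sup I) := sup_removedE I_interval Ia aI.

Let Jitv c d : J c -> J d -> `[c, d] `<=` J.
Proof. by rewrite JE; exact: half_open_itv. Qed.

Let Ja : J a. Proof. by rewrite JE; split. Qed.

Let disc := [set t | J t /\ ~ {for t, continuous gR}].

Let disc_countable : countable disc.
Proof. exact: right_limits_discontinuities. Qed.

Lemma interior_continuous_on_at c d x : `[c, d] `<=` J ->
  c <= x -> x <= d -> ~ disc x -> continuous_on_at gR c d x.
Proof.
move=> cdJ cx xd nx; apply: continuous_continuous_on_at; apply: contrapT => H.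
by apply: nx; split => //; apply: cdJ; rewrite /= in_itv /= cx.
Qed.

(** The compact intervals may end at the supremum of [I], where nothing is known
about [g]; the right end is therefore added to the exceptional points. *)
Lemma regulated_exceptional : exists2 Z : set R, countable Z &
  forall c d x, `[c, d] `<=` real_part I -> c <= x -> x <= d ->
    ~ (Z `|` [set d]) x -> continuous_on_at gR c d x.
Proof.
exists disc => // c d x cdI cx xd nZ.
apply: continuous_continuous_on_at; apply: contrapT => H; apply: nZ.
have [xE|xd'] := eqVneq x d; [by right|left; split => //].
have xlt : x < d by rewrite lt_neqAle xd'.
have Ix : I x%:E by apply: cdI; rewrite /= in_itv /= cx.
have Id : I d%:E.
  by apply: cdI; rewrite /= in_itv /= lexx (le_trans cx).
split => // xsup; have := ereal_sup_ubound Id.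
by rewrite -xsup lee_fin leNgt xlt.
Qed.

(** The point [a] is exceptional, as the derivative there would involve values on
its left. *)
Lemma exhaust_CD_primitive f :
  (forall d, J d -> a < d -> variational_primitive gR a d f) ->
  CD_primitive I g f.
Proof.
move=> fP; have next x : J x -> exists2 d, J d & x < d.
  by rewrite JE; exact: half_open_next.
have aJ x : J x -> a <= x by rewrite JE => -[].
split.
  apply: straddle_continuous_within => x Jx; have [d Jd xd] := next x Jx.
  exists a, d; split; [exact: aJ|exact: xd|move=> y Jy _; exact: aJ|].
  apply: (variational_continuous _ _ (fP d Jd _)); [exact: aJ|exact: ltW|].
  exact: le_lt_trans (aJ _ Jx) xd.
exists (EFin @` (disc `|` [set a])); split.
- apply: sub_countable (card_image_le _ _) _.
  by apply: countable_setU => //; exact: countable1.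
- by move=> _ [t [[[It _] _]|->] <-].
move=> t Jt nZ; have [d Jd td] := next t Jt.
have at_ : a < t.
  rewrite lt_neqAle aJ// andbT; apply/eqP => at_; apply: nZ.
  by exists t => //; right.
have nt : ~ disc t by move=> Zt; apply: nZ; exists t => //; left.
apply: (derivative_on_at_is_derive (g := gR) at_ td).
apply: (variational_derivative (ltW at_) (ltW td) (fP d Jd (lt_trans at_ td))).
by apply: interior_continuous_on_at => //; [exact: Jitv|exact: ltW|exact: ltW].
Qed.

Lemma CD_primitive_countable f : CD_primitive I g f ->
  exists2 Z : set R, countable Z & forall c d x, `[c, d] `<=` J ->
    c <= x -> x <= d -> straddle_continuous f c d x /\
      (~ Z x -> derivative_on_at gR f c d x).
Proof.
move=> [fc [Z [Zc ZI dZ]]]; exists [set t | Z t%:E].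
  by apply: countable_preimage_inj Zc => x y [].
move=> c d x cdJ cx xd; split; first exact: within_straddle_continuous fc.
move=> nZ; apply: is_derive_derivative_on_at; apply: dZ => //.
by apply: cdJ; rewrite /= in_itv /= cx.
Qed.

Lemma CD_primitive_variational f c d : CD_primitive I g f -> c <= d ->
  `[c, d] `<=` J -> variational_primitive gR c d f.
Proof.
move=> /CD_primitive_countable[Z Zc H] cd cdJ.
apply: (@derivative_variational _ _ Z) => // x cx xd Zx.
  by have [_] := H c d x cdJ cx xd; apply.
by have [] := H c d x cdJ cx xd.
Qed.

Lemma HL_CD_primitive : locally_on J (HL_integrable gR) <->
  exists f, CD_primitive I g f.
Proof.
split=> [H|[f fP] c d cd cdJ]; last first.
  by apply: variational_HL; apply: CD_primitive_variational fP (ltW cd) cdJ.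
have [f fP] : exists f, forall d, half_open a (ereal_sup I) d -> a < d ->
    variational_primitive gR a d f.
  apply: variational_exhaust => d Jd ad; apply: HL_variational => //.
  by apply: H => //; apply: Jitv; rewrite // JE.
by exists f; apply: exhaust_CD_primitive => d; rewrite JE; exact: fP.
Qed.

End Interval.

(** * Bounded right regulated maps *)

Section BoundedCase.
Context {R : realType} {E : normedModType R}.
Implicit Types (f g : R -> E) (c d : R).

Lemma bounded_betweenP g c d : bounded_between g c d <->
  exists M : R, forall x, c <= x -> x <= d -> `|g x| <= M.
Proof.
split=> [/ex_strict_bound_gt0[M _ H]|[M H]].
  exists M => x cx xd; apply/ltW/H; by rewrite /= in_itv /= cx.
exists M; split; first exact: num_real.
move=> M' /ltW MM' x /=; rewrite in_itv /= => /andP[cx xd].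
exact: le_trans (H x cx xd) MM'.
Qed.

Lemma bounded_variational_Lipschitz g f c d :
  variational_primitive g c d f -> bounded_between g c d ->
  Lipschitz_between f c d.
Proof.
move=> fP /bounded_betweenP[M gM].
have fM s t : c <= s -> s < t -> t <= d -> `|f t - f s| <= M * (t - s).
  move=> cs st td; have := @variational_increment _ _ g f s t 0 M st
    (variational_sub cs (ltW st) td fP).
  rewrite scaler0 subr0; apply=> x sx xt; rewrite subr0; apply: gM; lra.
exists M; split; first exact: num_real.
move=> M' /ltW MM' [x y] /= []; rewrite !in_itv /=.
move=> /andP[cx xd] /andP[cy yd].
apply: (@le_trans _ _ (M * `|x - y|)); last by rewrite ler_wpM2r.
have [xy|yx|->] := ltgtP x y; last by rewrite !subrr !normr0 mulr0.
  by rewrite distrC [`|x - y|]distrC (gtr0_norm (_ : 0 < y - x)) ?subr_gt0// fM.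
by rewrite (gtr0_norm (_ : 0 < x - y)) ?subr_gt0// fM.
Qed.

End BoundedCase.

Section RiemannPart.
Context {R : realType} {E : completeNormedModType R}.
Variables (I : set (\bar R)) (a : R) (g : \bar R -> E).
Hypotheses (I_interval : ereal_interval I) (Ia : I a%:E) (aI : lbound I a%:E)
  (a_lt_sup : (a%:E < ereal_sup I)%E) (g_reg : right_regulated I g).
Local Notation gR := (fun t : R => g t%:E).

(** The domination by [H x = M * x] has no exceptional points. *)
Lemma bounded_between_variational c d : c < d -> `[c, d] `<=` real_part I ->
  bounded_between gR c d -> exists f, variational_primitive gR c d f /\
    Riemann_integrable gR c d.
Proof.
move=> cd cdI /bounded_betweenP[M gM].
have [Z Zc gc] := regulated_exceptional g_reg.
have Zdc : countable (Z `|` [set d]).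
  by apply: countable_setU => //; exact: countable1.
have M0 : 0 <= M by apply: le_trans (gM c (lexx c) (ltW cd)).
have gcont x : c <= x -> x <= d -> ~ (Z `|` [set d]) x -> continuous_on_at gR c d x.
  by move=> cx xd; exact: gc.
have [f fP] : exists f, variational_primitive gR c d f.
  apply: variational_limit => //.
  apply: (@dominated_approximation _ _ _ _ (fun x => M * x)) Zdc gcont _ _ _ => //.
  - move=> x cx xd _ e e0; apply: straddleW => s t cs sx xt td st.
    rewrite -mulrBr mulrC.
    have h1 : `|g x%:E| * (t - s) <= M * (t - s).
      by rewrite ler_wpM2r ?subr_ge0 ?gM// ltW.
    have h2 : 0 < e * (t - s) by rewrite mulr_gt0// subr_gt0.
    lra.
  - by move=> s t cs st td; rewrite ler_wpM2l.
  - move=> x cx xd _ e e0; apply: straddle_imp (straddle_scale c d x M e0).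
    by move=> s t *; rewrite -mulrBr mulrC.
by exists f; split => //; exact: bounded_Riemann Zdc fP gM gcont.
Qed.

Lemma Riemann_bounded_between :
  locally_on (real_part I) (Riemann_integrable gR) <->
  locally_on (real_part I) (bounded_between gR).
Proof.
split=> H c d cd cdI; have := H c d cd cdI.
  by move=> /(Riemann_bounded cd) ?; apply/bounded_betweenP.
by move=> /(bounded_between_variational cd cdI)[f []].
Qed.

Lemma bounded_between_Lipschitz_primitive :
  locally_on (real_part I) (bounded_between gR) ->
  exists f, CD_primitive I g f /\
    locally_on (sup_removed I) (Lipschitz_between f).
Proof.
move=> gB; have JI : sup_removed I `<=` real_part I by move=> t [].
have gBJ c d : c < d -> `[c, d] `<=` sup_removed I -> bounded_between gR c d.
  by move=> cd cdJ; apply: gB => //; exact: subset_trans JI.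
have [f fP] : exists f, CD_primitive I g f.
  apply/(HL_CD_primitive I_interval Ia aI a_lt_sup g_reg) => c d cd cdJ.
  have [f [fP _]] := bounded_between_variational cd (subset_trans cdJ JI)
    (gBJ c d cd cdJ).
  exact: variational_HL fP.
exists f; split => // c d cd cdJ.
apply: bounded_variational_Lipschitz (gBJ c d cd cdJ).
exact: (CD_primitive_variational fP (ltW cd)).
Qed.

End RiemannPart.

(** * Indefinite Lebesgue integrals *)

(** The completed Lebesgue measure lives on the type of reals equipped with the
Caratheodory measurable sets, which [LT R] names; interval and Borel sets have to
be read in it explicitly. *)
Local Notation LM := (@completed_lebesgue_measure _).
Local Notation LT R := (caratheodory_type (wlength (@idfun R))^*%mu).

Section LebesgueSets.
Context {R : realType}.

Lemma Lebesgue_measurable (A : set R) : measurable A -> measurable (A : set (LT R)).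
Proof. exact: sub_caratheodory. Qed.

Lemma Lebesgue_measurable_itv (i : interval R) :
  measurable ([set` i] : set (LT R)).
Proof. by apply: Lebesgue_measurable; exact: measurable_itv. Qed.

Lemma Lebesgue_measurable_countable (A : set R) : countable A ->
  measurable (A : set (LT R)).
Proof.
by move=> Ac; apply: Lebesgue_measurable; exact: countable_measurable.
Qed.

Lemma Lebesgue_measure_itvoc (u v : R) : u <= v ->
  completed_lebesgue_measure `]u, v]%classic = (v - u)%:E.
Proof.
move=> uv; rewrite -[LHS]/(lebesgue_measure `]u, v]%classic).
rewrite lebesgue_measure_itv /= lte_fin; case: ltP => // vu.
by congr EFin; lra.
Qed.

Lemma Lebesgue_negligible_countable (A : set R) : countable A ->
  (@completed_lebesgue_measure R).-negligible A.
Proof.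
move=> Ac; exists A; split => //; first exact: Lebesgue_measurable_countable.
exact: countable_lebesgue_measure0.
Qed.

End LebesgueSets.

Lemma integral_truncation_tail d (T : measurableType d) (R : realType)
    (mu : {measure set T -> \bar R}) (D : set T) (h : T -> R) :
  measurable D -> mu.-integrable D (EFin \o h) -> (forall x, 0 <= h x) ->
  forall e : R, 0 < e ->
    exists n : nat, \int[mu]_(x in D) (h x - Num.min (h x) n%:R) <= e.
Proof.
move=> mD ih h0 e e0.
have mh : measurable_fun D h by apply/measurable_EFinP/(measurable_int mu).
pose tail (n : nat) x : R := h x - Num.min (h x) n%:R.
have mtail n : measurable_fun D (tail n).
  exact: measurable_funB mh (measurable_minr mh (measurable_cst _)).
have tail_ge0 n x : 0 <= tail n x by rewrite subr_ge0 ge_min lexx.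
have : (\int[mu]_(x in D) (tail n x)%:E)%E @[n --> \oo] --> 
    (\int[mu]_(x in D) (cst 0%:E) x)%E.
  apply: (@dominated_cvg _ _ _ _ _ mD _ _ (EFin \o h)) => //.
  - by move=> n; exact/measurable_EFinP.
  - move=> x _; apply: cvg_near_cst; near=> n; rewrite /tail.
    rewrite (min_idPl _) ?subrr//; near: n; exact: nbhs_infty_ger.
  - move=> n x _; rewrite /= lee_fin ger0_norm// gerBl.
    by rewrite le_min h0 ler0n.
rewrite integral0 => /fine_cvgP[_ /cvgrPdist_le/(_ e e0)[n _ /(_ n (leqnn n))]] /=.
by rewrite sub0r normrN => H; exists n; exact: le_trans (ler_norm _) H.
Unshelve. all: by end_near. Qed.

Section IndefiniteIntegral.
Context {R : realType}.
Variables (h : R -> R) (c d : R).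
Hypotheses (h0 : forall x, 0 <= h x)
  (ih : (@completed_lebesgue_measure R).-integrable `[c, d]%classic (EFin \o h)).

Definition indefinite_integral (x : R) : R :=
  \int[completed_lebesgue_measure]_(y in `]c, x]%classic) h y.
Local Notation H := indefinite_integral.

Let sub_integrable s t : c <= s -> t <= d ->
  (@completed_lebesgue_measure R).-integrable `]s, t]%classic (EFin \o h).
Proof.
move=> cs td; apply: integrableS ih; try exact: Lebesgue_measurable_itv.
by move=> y /=; rewrite !in_itv /= => /andP[sy yt]; apply/andP; split; lra.
Qed.

Lemma indefinite_integralB s t : c <= s -> s <= t -> t <= d ->
  H t - H s = \int[completed_lebesgue_measure]_(y in `]s, t]%classic) h y.
Proof.
move=> cs st td; rewrite /H (@itv_bndbnd_setU _ _ _ (BRight s)) ?bnd_simp//.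
rewrite Rintegral_setU ?[_ + _ - _]addrAC ?subrr ?add0r//.
- exact: Lebesgue_measurable_itv.
- exact: Lebesgue_measurable_itv.
- rewrite -itv_bndbnd_setU ?bnd_simp//; exact: sub_integrable.
- apply/disj_setPS => y /= []; rewrite !in_itv /= => /andP[_ ys] /andP[sy _]; lra.
Qed.

Let integrable_cst (k : R) s t : s <= t ->
  (@completed_lebesgue_measure R).-integrable `]s, t]%classic
    (EFin \o (fun=> k)).
Proof.
move=> st; apply: measurable_bounded_integrable => //.
- exact: Lebesgue_measurable_itv.
- by rewrite [X in (X < _)%E](Lebesgue_measure_itvoc st) ltry.
- exists `|k|; split; first exact: num_real.
  by move=> M /ltW kM y _.
Qed.

Let Rintegral_cst_itv (k : R) s t : s <= t ->
  \int[completed_lebesgue_measure]_(y in `]s, t]%classic) k = k * (t - s).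
Proof.
move=> st; rewrite Rintegral_cst; last exact: Lebesgue_measurable_itv.
by rewrite [X in _ * fine X](Lebesgue_measure_itvoc st).
Qed.

Lemma indefinite_integral_le (k : R) s t : c <= s -> s <= t -> t <= d ->
  (forall y, s < y -> y <= t -> h y <= k) -> H t - H s <= k * (t - s).
Proof.
move=> cs st td hk; rewrite indefinite_integralB// -Rintegral_cst_itv//.
apply: le_Rintegral; [exact: Lebesgue_measurable_itv|exact: sub_integrable|
  exact: integrable_cst|].
by move=> y /=; rewrite in_itv /= => /andP[sy yt]; exact: hk.
Qed.

Lemma indefinite_integral_ge (k : R) s t : c <= s -> s <= t -> t <= d ->
  (forall y, s < y -> y <= t -> k <= h y) -> k * (t - s) <= H t - H s.
Proof.
move=> cs st td hk; rewrite indefinite_integralB// -Rintegral_cst_itv//.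
apply: le_Rintegral; [exact: Lebesgue_measurable_itv|exact: integrable_cst|
  exact: sub_integrable|].
by move=> y /=; rewrite in_itv /= => /andP[sy yt]; exact: hk.
Qed.

Lemma indefinite_integral_nd s t : c <= s -> s <= t -> t <= d -> H s <= H t.
Proof.
move=> cs st td; rewrite -subr_ge0 indefinite_integralB//.
by apply: Rintegral_ge0 => y _.
Qed.

(** An integrable map is the sum of a bounded one and one of small integral.
This gives at once the continuity and the absolute continuity of its indefinite
integral. *)
Lemma indefinite_integral_tail (e : R) : 0 < e ->
  exists (n : nat) (k : R -> R), [/\ forall x, 0 <= k x,
    (@completed_lebesgue_measure R).-integrable `[c, d]%classic (EFin \o k),
    \int[completed_lebesgue_measure]_(y in `[c, d]%classic) k y <= e &
    forall s t, c <= s -> s <= t -> t <= d -> H t - H s <=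
      n%:R * (t - s) + \int[completed_lebesgue_measure]_(y in `]s, t]%classic) k y].
Proof.
move=> e0; have mcd := @Lebesgue_measurable_itv R `[c, d].
have [n Hn] := integral_truncation_tail mcd ih h0 e0.
have mh : measurable_fun (`[c, d]%classic : set (LT R)) h.
  exact/measurable_EFinP/(measurable_int LM).
have mk : measurable_fun (`[c, d]%classic : set (LT R))
    (fun x => h x - Num.min (h x) n%:R).
  exact: measurable_funB mh (measurable_minr mh (measurable_cst _)).
have k0 x : 0 <= h x - Num.min (h x) n%:R by rewrite subr_ge0 ge_min lexx.
have ik : (@completed_lebesgue_measure R).-integrable `[c, d]%classic
    (EFin \o (fun x => h x - Num.min (h x) n%:R)).
  apply: le_integrable ih => //; first exact/measurable_EFinP.
  by move=> x _; rewrite /= lee_fin !ger0_norm// gerBl le_min h0 ler0n.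
exists n, (fun x => h x - Num.min (h x) n%:R); split => //.
move=> s t cs st td; rewrite indefinite_integralB//.
have sub : `]s, t]%classic `<=` `[c, d]%classic.
  by move=> y /=; rewrite !in_itv /= => /andP[sy yt]; apply/andP; split; lra.
have ist : (@completed_lebesgue_measure R).-integrable `]s, t]%classic
    (EFin \o (fun x => h x - Num.min (h x) n%:R)).
  by apply: integrableS ik => //; exact: Lebesgue_measurable_itv.
rewrite -lerBlDr -RintegralB; [|exact: Lebesgue_measurable_itv|
  exact: sub_integrable|exact: ist].
rewrite -Rintegral_cst_itv//; apply: le_Rintegral.
- exact: Lebesgue_measurable_itv.
- apply: (@integrableB _ _ _ _ _ (Lebesgue_measurable_itv _) (EFin \o h) _ _ ist).
  exact: sub_integrable.
- exact: integrable_cst.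
- by move=> y _; rewrite opprB addrCA subrr addr0 ge_min lexx orbT.
Qed.

End IndefiniteIntegral.

(** * Absolute continuity, step functions and measurability *)

Section AbsoluteContinuity.
Context {R : realType}.
Variables (h : R -> R) (c d : R).
Hypotheses (h0 : forall x, 0 <= h x)
  (ih : (@completed_lebesgue_measure R).-integrable `[c, d]%classic (EFin \o h)).
Local Notation H := (indefinite_integral h c).

(** Intervals that are disjoint when open are still disjoint with their right
ends, so the integrals add up to the integral over a union. *)
Lemma sum_Rintegral_disjoint (k : R -> R) (n : nat) (u v : 'I_n -> R) :
  (forall x, 0 <= k x) ->
  (@completed_lebesgue_measure R).-integrable `[c, d]%classic (EFin \o k) ->
  (forall i, [/\ c <= u i, u i <= v i & v i <= d]) ->
  trivIset [set: 'I_n] (fun i => `]u i, v i[%classic) ->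
  \sum_i \int[completed_lebesgue_measure]_(y in `]u i, v i]%classic) k y <=
  \int[completed_lebesgue_measure]_(y in `[c, d]%classic) k y.
Proof.
move=> k0 ik uv tuv; pose F i : set R := `]u i, v i]%classic.
have mF i : measurable (F i : set (LT R)) by exact: Lebesgue_measurable_itv.
have Fsub i : F i `<=` `[c, d]%classic.
  have [cu _ vd] := uv i.
  by move=> y; rewrite /F /= !in_itv /= => /andP[uy yv]; apply/andP; split; lra.
have tF : trivIset [set: 'I_n] F.
  apply/trivIsetP => i j _ _ ij; apply/seteqP; split => // y [].
  rewrite /F /= !in_itv /= => /andP[uiy yvi] /andP[ujy yvj].
  have /trivIsetP/(_ i j Logic.I Logic.I ij)/seteqP[tij _] := tuv.
  apply: (tij ((Num.max (u i) (u j) + y) / 2)).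
  have : Num.max (u i) (u j) < y by rewrite gt_max uiy.
  have : u i <= Num.max (u i) (u j) by rewrite le_max lexx.
  have : u j <= Num.max (u i) (u j) by rewrite le_max lexx orbT.
  set m := Num.max _ _ => h1 h2 h3.
  by split; rewrite /= in_itv /=; apply/andP; split; lra.
have mk : measurable_fun (`[c, d]%classic : set (LT R)) (EFin \o k).
  exact: (measurable_int LM).
have finF i : (\int[completed_lebesgue_measure]_(y in F i) (k y)%:E)%E \is a fin_num.
  apply: integrable_fin_num => //.
  by apply: integrableS ik => //; exact: Lebesgue_measurable_itv.
have mcd := @Lebesgue_measurable_itv R `[c, d].
rewrite -lee_fin -sumEFin /Rintegral fineK; last exact: integrable_fin_num.
under eq_bigr do rewrite fineK ?finF//.
have DU : \big[setU/set0]_(i <- index_enum 'I_n) F i `<=` `[c, d]%classic.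
  by elim/big_ind: _ => // A B HA HB y [/HA|/HB].
rewrite -(ge0_integral_bigsetU LM mF).
- apply: ge0_subset_integral => //; first exact: bigsetU_measurable.
  by move=> x _; rewrite lee_fin.
- exact: index_enum_uniq.
- by apply: sub_trivIset tF.
- exact: measurable_funS mcd DU mk.
- by move=> x _; rewrite lee_fin.
Qed.

Lemma indefinite_integral_continuous x : c <= x -> x <= d -> forall e : R, 0 < e ->
  straddle c d x (fun s t => H t - H s <= e).
Proof.
move=> cx xd e e0; have e2 : 0 < e / 2 by lra.
have [n [k [k0 ik ke Hk]]] := indefinite_integral_tail h0 ih e2.
apply: straddle_imp (straddle_scale c d x n%:R e2) => s t cs sx xt td st hst.
have := Hk s t cs (ltW st) td.
have := @sum_Rintegral_disjoint k 1 (fun=> s) (fun=> t) k0 ik.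
rewrite big_ord_recl big_ord0 addr0 => /(_ (fun=> And3 cs (ltW st) td)) H1.
have := H1 ltac:(by apply/trivIsetP => i j _ _; rewrite !ord1 eqxx).
by move=> h1 h2; rewrite mulrC in hst; move: hst ke h1 h2; clear; lra.
Qed.

Lemma dominated_absolutely_continuous (E : normedModType R) (f : R -> E) :
  (forall s t, c <= s -> s <= t -> t <= d -> `|f t - f s| <= H t - H s) ->
  absolutely_continuous f c d.
Proof.
move=> fH e e0; have e2 : 0 < e / 2 by lra.
have [n [k [k0 ik ke Hk]]] := indefinite_integral_tail h0 ih e2.
have n1 : 0 < n%:R + 1 :> R by rewrite ltr_wpDl.
exists (e / 2 / (n%:R + 1)); split; first by rewrite divr_gt0.
move=> m u v uv tuv; rewrite ltr_pdivlMr// => small.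
have := sum_Rintegral_disjoint k0 ik uv tuv.
set S := \sum_i \int[_]_(_ in _) _ => HS.
have : \sum_i `|f (v i) - f (u i)| <= n%:R * \sum_i (v i - u i) + S.
  rewrite mulr_sumr -big_split /=; apply: ler_sum => i _.
  have [cu uvi vd] := uv i.
  exact: le_trans (fH _ _ cu uvi vd) (Hk _ _ cu uvi vd).
have : 0 <= \sum_i (v i - u i).
  by apply: sumr_ge0 => i _; have [_ ? _] := uv i; rewrite subr_ge0.
set L := \sum_i (v i - u i) in small * => L0 Hs.
have nL : n%:R * L <= L * (n%:R + 1) by rewrite mulrDr mulr1 mulrC lerDl.
by move: nL Hs HS ke small; clear; lra.
Qed.

End AbsoluteContinuity.

Section StepFunctions.
Context {R : realType}.
Implicit Types (c d h x : R).

Definition floor_to_grid c h x : R := c + (Num.truncn ((x - c) / h))%:R * h.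

Lemma floor_to_grid_itv c h x : 0 < h -> c <= x ->
  [/\ c <= floor_to_grid c h x, floor_to_grid c h x <= x &
      x < floor_to_grid c h x + h].
Proof.
move=> h0 cx; rewrite /floor_to_grid.
have xh : 0 <= (x - c) / h by rewrite divr_ge0 ?subr_ge0// ltW.
have /andP[] := truncn_itv xh; set k := Num.truncn _.
rewrite ler_pdivlMr// ltr_pdivrMr// -natr1 mulrDl mul1r => h1 h2.
by split; [rewrite lerDl mulr_ge0// ltW|lra|lra].
Qed.

(** The preimage is the trace of a countable union of grid cells, whatever [F]
is. *)
Lemma step_preimage_measurable (X : Type) (F : R -> X) (B : set X) c d h : 0 < h ->
  measurable (`[c, d] `&` (F \o floor_to_grid c h) @^-1` B : set (LT R)).
Proof.
move=> h0; pose t (k : nat) := c + k%:R * h.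
have -> : `[c, d]%classic `&` (F \o floor_to_grid c h) @^-1` B =
  \bigcup_(k in [set k | B (F (t k))]) (`[c, d]%classic `&` `[t k, t k.+1[%classic).
  apply/seteqP; split => [x [cdx Bx]|x [k Bk [cdx kx]]].
    exists (Num.truncn ((x - c) / h)) => //; split => //.
    move: cdx; rewrite /= !in_itv /= => /andP[cx _].
    have [_ h1 h2] := floor_to_grid_itv h0 cx.
    rewrite /t h1 (lt_le_trans h2)//.
    by rewrite -natr1 mulrDl mul1r addrA.
  split => //; suff : floor_to_grid c h x = t k by move=> /= ->.
  congr (c + _%:R * h); apply: truncn_def.
  move: kx; rewrite /= in_itv /= /t => /andP[h1 h2].
  by rewrite ler_pdivlMr// ltr_pdivrMr//; apply/andP; split; lra.
apply: bigcup_measurable => k _; apply: measurableI; exact: Lebesgue_measurable_itv.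
Qed.

Lemma step_simple (X : Type) (F : R -> X) c d h : 0 < h ->
  simple_on (`[c, d]%classic : set (LT R)) (F \o floor_to_grid c h).
Proof.
move=> h0; split; last by move=> y; exact: step_preimage_measurable.
apply: (@sub_finite_set _ _
  ((fun k : nat => F (c + k%:R * h)) @` `I_(Num.truncn ((d - c) / h)).+1)).
  move=> _ [x /= xcd <-]; exists (Num.truncn ((x - c) / h)) => //=.
  rewrite ltnS; apply: le_truncn; rewrite ler_pM2r ?invr_gt0// lerB//.
  by move: xcd; rewrite in_itv /= => /andP[].
by apply: finite_image; exact: finite_II.
Qed.

End StepFunctions.

Section Measurability.
Context {R : realType} {E : normedModType R}.
Variables (g : R -> E) (c d : R) (Z : set R).
Hypotheses (Zc : countable Z)
  (gc : forall x, c <= x -> x <= d -> ~ Z x -> continuous_on_at g c d x).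
Let s (n : nat) : R -> E := g \o floor_to_grid c n.+1%:R^-1.

Let s_cvg x : c <= x -> x <= d -> ~ Z x -> s n x @[n --> \oo] --> g x.
Proof.
move=> cx xd nZ; apply/cvgrPdist_le => e e0.
have [r r0 Hr] := gc cx xd nZ e0; near=> n; rewrite distrC.
have nr : n.+1%:R^-1 < r by near: n; exact: (near_infty_natSinv_lt (PosNum r0)).
have n0 : 0 < n.+1%:R^-1 :> R by rewrite invr_gt0.
have [h1 h2 h3] := floor_to_grid_itv n0 cx.
apply: Hr => //; first exact: le_trans h2 xd.
  by rewrite ltrBlDr (lt_trans h3)// ltrD2l.
by rewrite (le_lt_trans h2)// ltrDl.
Unshelve. all: by end_near. Qed.

(** The step functions take on each grid cell the value of [g] at its left end,
so they converge at the continuity points of [g]. *)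
Lemma continuous_strongly_measurable :
  strongly_measurable (@completed_lebesgue_measure R) `[c, d]%classic g.
Proof.
exists s; split; first by move=> n; apply: step_simple; rewrite invr_gt0.
apply: negligibleS (Lebesgue_negligible_countable Zc) => x /= nx.
apply: contrapT => nZ; apply: nx; rewrite in_itv /= => /andP[cx xd].
exact: s_cvg.
Qed.

Lemma continuous_norm_measurable :
  measurable_fun (`[c, d]%classic : set (LT R)) (fun x => `|g x|).
Proof.
have mcd := @Lebesgue_measurable_itv R `[c, d].
have mZ := Lebesgue_measurable_countable Zc.
rewrite -[X in measurable_fun X](setDUK (@subIsetl _ `[c, d]%classic Z)).
have mI := measurableI _ _ mcd mZ; have mD := measurableD mcd mI.
have [_] := @measurable_funU _ _ _ _ _ _ (fun x : LT R => `|g x|) mI mD.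
apply; split.
  move=> _ B _; apply: Lebesgue_measurable_countable.
  apply: sub_countable Zc; apply: subset_card_le.
  by move=> x [[]].
apply: (@measurable_fun_cvg _ (LT R) R _
  (fun (n : nat) (x : LT R) => `|s n x| : R)) => [n|x [xcd nxZ]].
  apply: (measurable_funS mcd); first by move=> x [].
  move=> _ B _; apply: (@step_preimage_measurable R R (fun x => `|g x|)).
  by rewrite invr_gt0.
move: (xcd); rewrite /= in_itv /= => /andP[cx xd].
by apply: cvg_norm; apply: s_cvg => // Zx; apply: nxZ.
Qed.

End Measurability.

(** * Bochner integrable right regulated maps *)

Section Variation.
Context {R : realType} {E : normedModType R}.
Implicit Types (f g : R -> E) (u v c d : R).

(** Where [f] has derivative [g], the truncations of the norm of [g] are at most
the norm of the derivative, so their indefinite integrals increase no faster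
than the variation function [V]; countably many points do not matter. The bound
passes to the limit by monotone convergence. *)
Lemma variation_bounds_integral g f (V : R -> R) (Z : set R) u v : u < v ->
  countable Z ->
  (forall x, u <= x -> x <= v -> ~ Z x -> continuous_on_at g u v x) ->
  (forall x, u <= x -> x <= v -> ~ Z x -> derivative_on_at g f u v x) ->
  (forall s t, u <= s -> s < t -> t <= v -> `|f t - f s| <= V t - V s) ->
  V v - V u <= 1 ->
  (\int[completed_lebesgue_measure]_(x in `]u, v]%classic) `|g x|%:E <= 1)%E.
Proof.
move=> uv Zc gc df fV V1.
have mg := continuous_norm_measurable Zc gc.
have muv := @Lebesgue_measurable_itv R `[u, v].
have muv' := @Lebesgue_measurable_itv R `]u, v].
have sub : `]u, v]%classic `<=` `[u, v]%classic.
  by move=> y /=; rewrite !in_itv /= => /andP[sy ->]; rewrite (ltW sy).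
pose h (n : nat) x : R := Num.min `|g x| n%:R.
have h0 n x : 0 <= h n x by rewrite le_min normr_ge0 ler0n.
have mh n : measurable_fun (`[u, v]%classic : set (LT R)) (h n).
  exact: measurable_minr.
have ih n : (@completed_lebesgue_measure R).-integrable `[u, v]%classic
    (EFin \o h n).
  apply: measurable_bounded_integrable => //.
    rewrite [X in (X < _)%E](lebesgue_measure_itv `[u, v]) /= lte_fin uv.
    by rewrite -EFinB ltry.
  exists n%:R; split; first exact: num_real.
  move=> M /ltW nM x _; rewrite /= ger0_norm//.
  by apply: le_trans nM; rewrite ge_min lexx orbT.
have bound n : indefinite_integral (h n) u v - indefinite_integral (h n) u u <= 1.
  apply: le_trans V1; rewrite -subr_le0; set H := indefinite_integral (h n) u.
  have V_nd s t : u <= s -> s < t -> t <= v -> 0 <= V t - V s.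
    by move=> us st tv; apply: le_trans (fV s t us st tv).
  apply: (@small_subadditive R Z (fun s t => H t - H s - (V t - V s))) => //.
  - by move=> *; lra.
  - move=> x ux xv Zx e e0; have e2 : 0 < e / 2 by lra.
    have [r r0 Hr] := gc x ux xv Zx _ e2.
    apply: straddle_imp (straddle_and (straddle_near u v x r0) (df x ux xv Zx _ e2)).
    move=> s t us sx xt tv st [[rs tr] fst].
    have H1 : H t - H s <= (`|g x| + e / 2) * (t - s).
      apply: (indefinite_integral_le (ih n)) => //; first exact: ltW.
      move=> y sy yt; apply: (@le_trans _ _ `|g y|); first by rewrite ge_min lexx.
      have := Hr y (le_trans us (ltW sy)) (le_trans yt tv) (lt_trans rs sy)
        (le_lt_trans yt tr).
      by have := ler_normD (g y - g x) (g x); rewrite subrK; clear; lra.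
    have H2 : (t - s) * `|g x| <= `|f t - f s| + e / 2 * (t - s).
      have := ler_normB (f t - f s) (f t - f s - (t - s) *: g x).
      rewrite subKr normrZ gtr0_norm ?subr_gt0//; lra.
    have := fV s t us st tv; lra.
  - move=> x ux xv _ e e0; apply: straddle_imp (straddle_scale u v x n%:R e0).
    move=> s t us sx xt tv st Hst; have := V_nd s t us st tv.
    have : H t - H s <= n%:R * (t - s).
      apply: (indefinite_integral_le (ih n)) => //; first exact: ltW.
      by move=> y _ _; rewrite ge_min lexx orbT.
    by rewrite mulrC; lra.
have bound' n : (\int[completed_lebesgue_measure]_(x in `]u, v]%classic)
    (h n x)%:E <= 1)%E.
  have := bound n; rewrite (indefinite_integralB (ih n)) ?(ltW uv)//.
  rewrite -lee_fin /Rintegral fineK//; apply: integrable_fin_num => //.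
  exact: integrableS (ih n).
have mono := @cvg_monotone_convergence _ _ _ LM _ muv' (fun n x => (h n x)%:E).
have {mono} : (\int[completed_lebesgue_measure]_(x in `]u, v]%classic)
    (h n x)%:E)%E @[n --> \oo] -->
    (\int[completed_lebesgue_measure]_(x in `]u, v]%classic) `|g x|%:E)%E.
  have -> : (\int[completed_lebesgue_measure]_(x in `]u, v]%classic) `|g x|%:E)%E =
      (\int[completed_lebesgue_measure]_(x in `]u, v]%classic)
        (fun y => limn (fun n => (h n y)%:E)) x)%E.
    apply: eq_integral => x _; apply/esym/cvg_lim => //; apply: cvg_near_cst.
    near=> n; congr EFin; apply: min_idPl; near: n; exact: nbhs_infty_ger.
  apply: mono.
  - by move=> n; apply/measurable_EFinP; exact: measurable_funS (mh n).
  - by move=> n x _; rewrite lee_fin.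
  - move=> x _ n m nm; rewrite lee_fin le_min !ge_min lexx /=.
    by rewrite ler_nat nm orbT.
move=> L; rewrite -(cvg_lim _ L)//; apply: lime_le.
  by apply/cvg_ex; eexists; exact: L.
by near=> n; exact: bound'.
Unshelve. all: by end_near. Qed.

(** The variation is at most [1] on short intervals; interval induction adds the
integrals of the norm over these. *)
Lemma absolutely_continuous_Bochner g f (Z : set R) c d : c < d ->
  countable Z ->
  (forall x, c <= x -> x <= d -> ~ Z x -> continuous_on_at g c d x) ->
  (forall x, c <= x -> x <= d -> ~ Z x -> derivative_on_at g f c d x) ->
  absolutely_continuous f c d -> Bochner_integrable g c d.
Proof.
move=> cd Zc gc df fAC; split; first exact: continuous_strongly_measurable Zc gc.
have mg := continuous_norm_measurable Zc gc.
have [r r0 Hr] := absolutely_continuous_variation fAC.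
have mitv (i : interval R) := @Lebesgue_measurable_itv R i.
have msub (i : interval R) : [set` i] `<=` `[c, d]%classic ->
    measurable_fun ([set` i] : set (LT R)) (fun x => `|g x|%:E).
  by move=> icd; apply/measurable_EFinP; exact: measurable_funS (mitv _) icd mg.
have sub u v : c <= u -> v <= d -> `]u, v]%classic `<=` `[c, d]%classic.
  by move=> cu vd y /=; rewrite !in_itv /= => /andP[uy yv]; apply/andP; split; lra.
have : (\int[completed_lebesgue_measure]_(x in `]c, d]%classic) `|g x|%:E < +oo)%E.
  apply: (@interval_ind R (fun u v =>
    (\int[completed_lebesgue_measure]_(x in `]u, v]%classic) `|g x|%:E
      < +oo)%E)) => //.
    move=> u v w cu uv vw wd Iuv Ivw.
    have uvw : `]u, w]%classic = `]u, v]%classic `|` `]v, w]%classic.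
      by rewrite -itv_bndbnd_setU ?bnd_simp// ltW.
    rewrite uvw (ge0_integral_setU LM (mitv _) (mitv _)).
    - exact: lte_add_pinfty.
    - by rewrite -uvw; apply: msub; exact: sub.
    - by [].
    - apply/disj_setPS => y /= []; rewrite !in_itv /= => /andP[_ ?] /andP[? _].
      lra.
  move=> x cx xd; exists (r / 2); first by lra.
  move=> u v cu ux xv vd uv xu vx.
  have [V [V1 fV]] := Hr u v cu uv vd ltac:(lra).
  apply: (@le_lt_trans _ _ 1%E); last exact: ltry.
  apply: (variation_bounds_integral uv Zc _ _ fV V1) => y uy yv Zy.
    move=> e e0; have [q q0 Hq] := gc y ltac:(lra) ltac:(lra) Zy e e0.
    by exists q => // z uz zv; apply: Hq; lra.
  move=> e e0; have := df y ltac:(lra) ltac:(lra) Zy e e0.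
  by apply: straddle_mono.
move=> Icd; apply/integrableP; split; first by apply/measurable_EFinP.
under eq_integral do rewrite /= normr_id.
rewrite -(@setU1itv _ _ _ _ false) ?bnd_simp ?ltW//.
have Dcd : [set c] `|` `]c, d]%classic = `[c, d]%classic.
  by rewrite setU1itv ?bnd_simp ?ltW.
have mc : measurable ([set c] : set (LT R)).
  by apply: Lebesgue_measurable_countable; exact: countable1.
rewrite (ge0_integral_setU LM mc (mitv _)).
- have mgc : measurable_fun ([set c] : set (LT R)) (fun x => `|g x|%:E).
    apply/measurable_EFinP; apply: measurable_funS (mitv _) _ mg.
    by rewrite -Dcd; exact: subsetUl.
  have c0 : completed_lebesgue_measure [set c] = 0%E.
    by apply: countable_lebesgue_measure0; exact: countable1.
  by rewrite (null_set_integral mc mgc c0) add0e.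
- by rewrite Dcd; apply/measurable_EFinP.
- by [].
- by apply/disj_setPS => y /= [-> ]; rewrite in_itv /= ltxx.
Qed.

(** The derivative of the indefinite integral of the norm is the norm, at the
continuity points. *)
Lemma norm_domination g c d x : c <= x -> x <= d ->
  (@completed_lebesgue_measure R).-integrable `[c, d]%classic
    (EFin \o (fun y => `|g y|)) ->
  continuous_on_at g c d x -> forall e : R, 0 < e ->
  straddle c d x (fun s t => (t - s) * `|g x| <=
    indefinite_integral (fun y => `|g y|) c t -
    indefinite_integral (fun y => `|g y|) c s + e * (t - s)).
Proof.
move=> cx xd ig gx e e0; have [r r0 Hr] := gx e e0.
exists r => // s t cs sx xt td st rs tr.
have := @indefinite_integral_ge _ _ _ _ ig
  (`|g x| - e) s t cs (ltW st) td.
rewrite mulrBl mulrC => H; have : forall y, s < y -> y <= t -> `|g x| - e <= `|g y|.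
  move=> y sy yt.
  have := Hr y (le_trans cs (ltW sy)) (le_trans yt td) (lt_trans rs sy)
    (le_lt_trans yt tr).
  by have := ler_normB (g y) (g y - g x); rewrite subKr; clear; lra.
by move=> /H; lra.
Qed.

(** The mean value inequality gives [`|f v - f u| <= H v - H u] for the
indefinite integral [H] of the norm. *)
Lemma Bochner_variational_absolutely_continuous g f (Z : set R) c d : c < d ->
  countable Z ->
  (forall x, c <= x -> x <= d -> ~ Z x -> continuous_on_at g c d x) ->
  Bochner_integrable g c d -> variational_primitive g c d f ->
  absolutely_continuous f c d.
Proof.
move=> cd Zc gc [_ ig] fP; have n0 y : 0 <= `|g y| by [].
apply: (dominated_absolutely_continuous n0 ig) => u v cu.
rewrite le_eqVlt => /predU1P[->|uv vd]; first by rewrite !subrr normr0.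
set H := indefinite_integral _ _.
rewrite -subr_le0.
apply: (@small_subadditive R Z (fun s t => `|f t - f s| - (H t - H s))) => //.
- move=> x y z ux xy yz zv; have := ler_normD (f y - f x) (f z - f y).
  by rewrite addrC subrKA; lra.
- move=> x ux xv Zx e e0; have e2 : 0 < e / 2 by lra.
  have cx : c <= x by lra.
  have xd : x <= d by lra.
  have gx := gc x cx xd Zx.
  apply: straddle_mono cu vd _ (straddle_and
    (variational_derivative cx xd fP gx e2) (norm_domination cx xd ig gx e2)).
  move=> s t us sx xt tv st [h1 h2].
  have := ler_normD (f t - f s - (t - s) *: g x) ((t - s) *: g x).
  rewrite subrK normrZ gtr0_norm ?subr_gt0//; rewrite -/H in h2; lra.
- move=> x ux xv Zx e e0.
  have cx : c <= x by lra.
  have xd : x <= d by lra.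
  apply: (straddle_mono cu vd _ (variational_continuous cx xd fP e0)).
  move=> s t us sx xt tv st h1.
  have : H s <= H t.
    exact: (indefinite_integral_nd n0 ig (le_trans cu us) (ltW st) (le_trans tv vd)).
  by move: h1; clear; lra.
Qed.

End Variation.

Section BochnerPart.
Context {R : realType} {E : completeNormedModType R}.
Implicit Types (f g : R -> E) (c d : R).

Lemma Bochner_variational g (Z : set R) c d : c < d -> countable Z ->
  (forall x, c <= x -> x <= d -> ~ Z x -> continuous_on_at g c d x) ->
  Bochner_integrable g c d -> exists f, variational_primitive g c d f.
Proof.
move=> cd Zc gc [_ ig]; apply: variational_limit => //.
apply: (dominated_approximation (H := indefinite_integral (fun y => `|g y|) c)
  cd Zc gc).
- by move=> x cx xd Zx; apply: norm_domination => //; exact: gc.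
- exact: indefinite_integral_nd.
- by move=> x cx xd _; exact: indefinite_integral_continuous.
Qed.

Variables (I : set (\bar R)) (a : R) (g : \bar R -> E).
Hypotheses (I_interval : ereal_interval I) (Ia : I a%:E) (aI : lbound I a%:E)
  (a_lt_sup : (a%:E < ereal_sup I)%E) (g_reg : right_regulated I g).
Local Notation gR := (fun t : R => g t%:E).
Local Notation J := (sup_removed I).

Lemma Bochner_CD_primitive : locally_on J (Bochner_integrable gR) <->
  exists f, CD_primitive I g f /\ locally_on J (absolutely_continuous f).
Proof.
have [Z Zc gc] := regulated_exceptional g_reg.
have JI c d : `[c, d] `<=` J -> `[c, d] `<=` real_part I.
  by move=> cdJ t /cdJ[].
have Zdc d : countable (Z `|` [set d]).
  by apply: countable_setU => //; exact: countable1.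
have gcd c d : `[c, d] `<=` J -> forall x, c <= x -> x <= d ->
    ~ (Z `|` [set d]) x -> continuous_on_at gR c d x.
  by move=> cdJ x; apply: gc; exact: JI.
split=> [gB|[f [fP fAC]] c d cd cdJ].
  have [f fP] : exists f, CD_primitive I g f.
    apply/(HL_CD_primitive I_interval Ia aI a_lt_sup g_reg) => c d cd cdJ.
    have [f fP] := Bochner_variational cd (Zdc d) (gcd c d cdJ) (gB c d cd cdJ).
    exact: variational_HL fP.
  exists f; split => // c d cd cdJ.
  apply: (Bochner_variational_absolutely_continuous cd (Zdc d) (gcd c d cdJ)
    (gB c d cd cdJ)).
  exact: CD_primitive_variational fP (ltW cd) cdJ.
have [Z' Z'c fd] := CD_primitive_countable fP.
apply: (@absolutely_continuous_Bochner _ _ _ f ((Z `|` [set d]) `|` Z')) => //.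
- exact: countable_setU.
- by move=> x cx xd nZ; apply: gcd => // Zx; apply: nZ; left.
- move=> x cx xd nZ; have [_] := fd c d x cdJ cx xd.
  by apply => Zx; apply: nZ; right.
- exact: fAC.
Qed.

End BochnerPart.

Theorem theorem4p1 (R : realType) (E : completeNormedModType R)
    (I : set (\bar R)) (a : R) (g : \bar R -> E)
    (I_interval : ereal_interval I)
    (a_min : I a%:E /\ lbound I a%:E)
    (a_lt_sup : (a%:E < ereal_sup I)%E)
    (g_reg : right_regulated I g) :
  let gR : R -> E := fun t => g t%:E in
  [/\ locally_on (sup_removed I) (HL_integrable gR) <->
      (exists f : R -> E, CD_primitive I g f),
      locally_on (sup_removed I) (Bochner_integrable gR) <->
      (exists f : R -> E, CD_primitive I g f /\
         locally_on (sup_removed I) (absolutely_continuous f)) &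
      (locally_on (real_part I) (Riemann_integrable gR) <->
       locally_on (real_part I) (bounded_between gR)) /\
      (locally_on (real_part I) (bounded_between gR) ->
       exists f : R -> E, CD_primitive I g f /\
         locally_on (sup_removed I) (Lipschitz_between f))].
Proof.
have [Ia aI] := a_min; move=> gR; split.
- exact: HL_CD_primitive I_interval Ia aI a_lt_sup g_reg.
- exact: Bochner_CD_primitive I_interval Ia aI a_lt_sup g_reg.
- split; first exact: Riemann_bounded_between g_reg.
  exact: bounded_between_Lipschitz_primitive I_interval Ia aI a_lt_sup g_reg.
Qed.
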